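(* Let $H$ be a many-body Hamiltonian on $\mathbb R^n$, $\lambda\in\mathbb R$. Suppose that $\Lambda_1$ is discrete and $\gamma:\mathbb R\to\dot\Sigma(\lambda)$ is a continuous curve. Then $\gamma$ is a generalized broken bicharacteristic of $H-\lambda$ if and only if there exist $t_0<t_1<\ldots<t_k$ such that each $\gamma|_{[t_j,t_{j+1}]}$, as well as $\gamma|_{(-\infty,t_0]}$ and $\gamma|_{[t_k,+\infty)}$, is the projection (image under $\pi_a$) of an integral curve, contained in $\Sigma_a(\lambda)$, of the Hamilton vector field ${}^{sc}H_g^a$ for some $a$ (depending on the segment). Similar results hold if the interval of definition, $\mathbb R$, is replaced by any interval.
   Context: Many-body Hamiltonian. $\{X_a\}_{a\in I}$ is a finite family of linear subspaces of Euclidean $\mathbb R^n$, closed under intersections, containing $X_0=\mathbb R^n$ and $X_1=\{0\}$. $X^a=X_a^\perp$, $\pi^a$ is the orthogonal projection to $X^a$; $\xi=(\xi_a,\xi^a)$ is the splitting along $X_a\oplus X^a$ (dual spaces identified via the metric). $a\le b$ means $X^a\subset X^b$. $H=\Delta+\sum_a(\pi^a)^*V_a$ with $\Delta\ge0$ the positive Laplacian, $V_0=0$, $V_a$ real-valued and $V_a\in S^{-1}_{\rm phg}(X^a)$ (classical one-step polyhomogeneous symbols of order $-1$). $H^a=\Delta_{X^a}+\sum_{b\le a}V_b$ on $L^2(X^a)$ ($H^0=0$ on $L^2(\{0\})=\mathbb C$). $\mathrm{spec}_{pp}$ denotes the set of $L^2$-eigenvalues. $\Lambda_1=\bigcup_{b<1}\mathrm{spec}_{pp}(H^b)$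 is the set of thresholds (closed and bounded, so discrete means finite). Phase space. $C_a=X_a\cap\mathbb S^{n-1}$, $C_a'=C_a\setminus\bigcup_{b\not\le a}C_b$; the $C'_a$ partition $\mathbb S^{n-1}$. $\dot T=\bigsqcup_a C_a'\times X_a$, $\pi:\mathbb S^{n-1}\times\mathbb R^n\to\dot T$, $\pi(\omega,\xi)=(\omega,\xi_a)$ for $\omega\in C_a'$; $\dot T$ has the quotient topology. $\pi_b:C_b\times X_b\to\dot T$ is the restriction of $\pi$ to $C_b\times X_b\subset\mathbb S^{n-1}\times\mathbb R^n$. $\Sigma_b(\lambda)=\{(\omega,\xi_b)\in C_b\times X_b:\lambda-|\xi_b|^2\in\mathrm{spec}_{pp}(H^b)\}$, $\hat\pi_b=\pi_b|_{\Sigma_b(\lambda)}$, $\dot\Sigma(\lambda)=\bigcup_b\pi_b(\Sigma_b(\lambda))$. Generalized broken bicharacteristics. The rescaled Hamilton vector field ${}^{sc}H_g^b$ on $C_b\times X_b$ is $\dot\omega=2(\xi_b-(\omega\cdot\xi_b)\omega)$, $\dot\xi_b=0$. $f\in C^\infty(\mathbb S^{n-1}\times\mathbb R^n)$ is $\pi$-invariant if $f=f_\pi\circ\pi$ for some $f_\pi$ on $\dot T$. A generalized broken bicharacteristic of $H-\lambda$ is a continuous $\gamma:J\to\dot\Sigma(\lambda)$, $J\subset\mathbb R$ an interval, such that for all $t_0\in J$, both signs, and all $\pi$-invariant $f$: if $\gamma(t_0)=\xi_0\in C_a'\times X_a$, then $D_\pm(f_\pi\circ\gamma)(t_0)\ge\inf\{{}^{sc}H_g^bf(\tilde\xi_0):\tilde\xi_0\in\hat\pi_b^{-1}(\xi_0),\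 C_a\subset C_b\}$, where $D_\pm h(t_0)=\liminf_{t\to t_0\pm}(h(t)-h(t_0))/(t-t_0)$. *)

(* Defs.v *)
From HB Require Import structures.
From mathcomp Require Import all_boot all_order all_algebra sesquilinear.
From mathcomp.real_closed Require Import complex.
From mathcomp Require Import all_classical all_reals all_analysis.
Set Implicit Arguments.
Unset Strict Implicit.
Unset Printing Implicit Defensive.
Import Order.TTheory GRing.Theory Num.Theory.
Import numFieldNormedType.Exports.
Local Open Scope classical_set_scope.
Local Open Scope ring_scope.

(* The norm of 'rV[R]_n in the library is the sup norm; it is used here only
   for its topology.  All metric notions are derived from [dot]. *)
Section Euclidean.
Context {R : realType} {n : nat}.
Local Notation E := 'rV[R]_n.
Implicit Types (x y : E) (U : {vspace E}).

Definition dot x y : R := \sum_(i < n) x 0 i * y 0 i.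

Lemma dot_bilinear : bilinear_for
  ( *%R : GRing.Scale.law R R) (idfun \; *%R : GRing.Scale.law R R) dot.
Proof.
split=> [y|x] a u v; rewrite /dot /= mulr_sumr -big_split /=;
  apply: eq_bigr => i _; rewrite !mxE.
  by rewrite mulrDl mulrA.
by rewrite mulrDr mulrCA.
Qed.

Lemma dot_hermitian x y : dot x y = (-1) ^+ false * idfun (dot y x).
Proof. by rewrite mul1r; apply: eq_bigr => i _; rewrite mulrC. Qed.

Lemma dot_gt0 x : x != 0 -> 0 < dot x x.
Proof.
move=> x0; rewrite lt_neqAle sumr_ge0 ?andbT; last first.
  by move=> i _; rewrite -expr2 sqr_ge0.
apply: contra x0; rewrite eq_sym psumr_eq0; last first.
  by move=> i _; rewrite -expr2 sqr_ge0.
move=> /allP x0; apply/eqP/rowP => i; rewrite mxE.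
by have /x0 := mem_index_enum i; rewrite /= mulf_eq0 orbb => /eqP.
Qed.

HB.instance Definition _ := bilinear_isBilinear.Build R E E R
  ( *%R : GRing.Scale.law R R) (idfun \; *%R : GRing.Scale.law R R)
  dot dot_bilinear.
HB.instance Definition _ :=
  isHermitianSesquilinear.Build R E false idfun dot dot_hermitian.
HB.instance Definition _ := isDotProduct.Build R E dot dot_gt0.

Definition enorm x : R := Num.sqrt (dot x x).

Definition perp U : {vspace E} := orthov dot U.

Lemma mem_perp U x : reflect {in U, forall y, dot x y = 0} (x \in perp U).
Proof. exact: mem_orthovP. Qed.

Lemma capv_perp U : (U :&: perp U = 0)%VS.
Proof.
apply/eqP; rewrite -subv0; apply/subvP => x /memv_capP[xU /mem_perp/(_ x xU) x0].
rewrite memv0; apply: contraT => /dot_gt0.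
by rewrite x0 ltxx.
Qed.

Lemma addv_perp U : (U + perp U = fullv)%VS.
Proof.
pose f (x : E) : 'rV[R]_(\dim U) := \row_i dot x (vbasis U)`_i.
have fL : linear f.
  by move=> a x y; apply/rowP => i; rewrite !mxE linearPl.
pose fl := GRing.isLinear.Build R E 'rV[R]_(\dim U) _ f fL.
pose F := linfun (HB.pack_for {linear E -> 'rV[R]_(\dim U)} f fl).
have kerF : (lker F <= perp U)%VS.
  apply/subvP => x; rewrite memv_ker lfunE /= => /eqP fx0.
  apply/mem_perp => y /coord_vbasis ->; rewrite linear_sumr big1 // => i _.
  rewrite linearZ /=; have /rowP/(_ i) := fx0; rewrite !mxE => ->.
  by rewrite mulr0.
apply/eqP; rewrite eqEdim subvf /= (dimv_disjoint_sum (capv_perp U)).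
have := limg_ker_dim F fullv; rewrite capfv => <-; rewrite addnC leq_add //.
  by rewrite (leq_trans (dimvS (subvf _))) // dimvf /dim /= mul1n.
exact: dimvS.
Qed.

Definition oproj U : E -> E := daddv_pi U (perp U).

Lemma oproj_mem U x : oproj U x \in U.
Proof. exact: memv_pi. Qed.

Lemma oproj_perp U x : x - oproj U x \in perp U.
Proof.
have := daddv_pi_add (capv_perp U) (_ : x \in U + perp U)%VS.
rewrite addv_perp memvf => /(_ isT) {1}<-.
by rewrite addrAC subrr add0r memv_pi.
Qed.

End Euclidean.

Section Smooth.
Context {R : realType} {W : normedModType R}.
Implicit Types (f : W -> R) (vs : seq W) (A : set W).

Definition iterD vs f : W -> R := foldr (fun v g => 'D_v g) f vs.

(* C^oo on the open set [A], for a finite-dimensional [W]. *)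
Definition smooth_on A f := forall vs x, A x -> differentiable (iterD vs f) x.

End Smooth.

(* [S^{-1}_phg(U)] for a linear subspace [U] of R^n.  Only the values of [V] on
   [U] matter; they are transported to R^n by the orthogonal projection, and the
   derivatives are taken along [U].  [h j] is the term of degree -1-j of the
   expansion; the estimate for [N = 0] is the symbol estimate of order -1. *)
Definition phg_symbol_m1 {R : realType} {n : nat} (U : {vspace 'rV[R]_n})
    (V : 'rV[R]_n -> R) : Prop :=
  smooth_on setT (V \o oproj U) /\
  exists h : nat -> 'rV[R]_n -> R,
    [/\ forall j, smooth_on [set x | oproj U x != 0] (h j \o oproj U),
        forall j (r : R) x, 0 < r -> x \in U -> x != 0 ->
          h j (r *: x) = r ^- j.+1 * h j x &
        forall (N : nat) (vs : seq 'rV[R]_n), {subset vs <= U} ->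
          exists C : R, forall x, x \in U -> 1 <= enorm x ->
            `| iterD vs (fun y => V (oproj U y)
                           - \sum_(j < N) h j (oproj U y)) x |
            <= C * enorm x ^- (1 + N + size vs) ].

Section Lebesgue.
Context {R : realType}.
Local Notation mR := (measurableTypeR R).

Definition cons_tuple d (p : d.-tuple mR * mR) : d.+1.-tuple mR :=
  [tuple of p.2 :: p.1].

Lemma measurable_cons_tuple d : measurable_fun setT (@cons_tuple d).
Proof. exact: measurable_cons. Qed.

Definition leb_succ d (m : {measure set (d.-tuple mR) -> \bar R}) :
    {measure set (d.+1.-tuple mR) -> \bar R} :=
  measure_function_pushforward__canonical__measure_function_Measure
    (m \x @lebesgue_measure R)%E (@measurable_cons_tuple d).

(* Lebesgue measure on R^d; for [d = 0] it is the unit mass of the point. *)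
Fixpoint leb d : {measure set (d.-tuple mR) -> \bar R} :=
  match d with
  | 0%N => dirac [tuple]
  | d'.+1 => leb_succ (leb d')
  end.

End Lebesgue.

(* Schroedinger operators on L^2(R^d), complex-valued functions. *)
Section Schroedinger.
Context {R : realType} (d : nat).
Local Notation mR := (measurableTypeR R).
Local Notation C := (R[i]).
Implicit Types (W phi : 'rV[R]_d -> R) (u w : d.-tuple mR -> C).

Definition tuple_rV (y : d.-tuple mR) : 'rV[R]_d := \row_i tnth y i.

Definition laplacian phi (y : 'rV[R]_d) : R :=
  - \sum_(i < d) 'D_(delta_mx 0 i) ('D_(delta_mx 0 i) phi) y.

Definition test_function phi : Prop :=
  smooth_on setT phi /\ exists M : R, forall y, M < enorm y -> phi y = 0.

Definition L2 u : Prop :=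
  [/\ measurable_fun setT (fun y => complex.Re (u y) : mR),
      measurable_fun setT (fun y => complex.Im (u y) : mR) &
      (\int[leb d]_y (complex.Re (u y) ^+ 2 + complex.Im (u y) ^+ 2)%:E < +oo)%E].

Definition Cintegral u : C :=
  Complex (Rintegral (leb d) setT (fun y => complex.Re (u y)))
          (Rintegral (leb d) setT (fun y => complex.Im (u y))).

(* [w = (Delta + W) u] for the self-adjoint realization of [Delta + W]: for a
   bounded real potential [W] its domain H^2(R^d) is the set of [u] in L^2 for
   which the distribution (Delta + W) u is in L^2. *)
Definition schroedinger_graph W u w : Prop :=
  [/\ L2 u, L2 w & forall phi, test_function phi ->
    Cintegral (fun y => let x := tuple_rV y in
                 real_complex R (laplacian phi x + W x * phi x) * u y) =
    Cintegral (fun y => real_complex R (phi (tuple_rV y)) * w y)].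

Definition L2_eigenvalue W (mu : R) : Prop :=
  exists u, ~ {ae leb d, forall y, u y = 0} /\
    schroedinger_graph W u (fun y => real_complex R mu * u y).

End Schroedinger.

(* [mb_X a] is X_a, so that X^a is [perp (mb_X a)]; [mb_V a] is V_a, of which
   only the values on X^a matter; [mb_0] and [mb_1] are the indices 0 and 1. *)
Record manyBody (R : realType) (n : nat) (I : finType) := ManyBody {
  mb_X : I -> {vspace 'rV[R]_n};
  mb_V : I -> 'rV[R]_n -> R;
  mb_0 : I;
  mb_1 : I;
  mb_X_inj : injective mb_X;
  mb_X_cap : forall a b, exists c, mb_X c = (mb_X a :&: mb_X b)%VS;
  mb_X_0 : mb_X mb_0 = fullv;
  mb_X_1 : mb_X mb_1 = 0%VS;
  mb_V_0 : mb_V mb_0 = fun=> 0;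
  mb_V_phg : forall a, phg_symbol_m1 (perp (mb_X a)) (mb_V a)
}.

Section ManyBodyTheory.
Context {R : realType} {n : nat} {I : finType} (M : manyBody R n I).
Local Notation E := 'rV[R]_n.
Local Notation X := (mb_X M).
Local Notation V := (mb_V M).
Implicit Types (a b : I) (omega xi : E) (p : E * E) (lambda t : R).
Implicit Types (J : set R) (gamma : R -> E * E).

Definition le_index a b := (perp (X a) <= perp (X b))%VS.
Definition lt_index a b := le_index a b && (a != b).

(* L^2(X^a) is identified with L^2(R^d) by an orthonormal basis of X^a, the
   rows of [B]. *)
Definition orthonormal_basis d (B : 'M[R]_(d, n)) (U : {vspace E}) : Prop :=
  B *m B^T = 1%:M /\ forall x, x \in U <-> exists y : 'rV[R]_d, x = y *m B.

Definition potential a (x : E) : R :=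
  \sum_(b | le_index b a) V b (oproj (perp (X b)) x).

Definition spec_pp a : set R :=
  [set mu | exists d (B : 'M[R]_(d, n)), orthonormal_basis B (perp (X a)) /\
     L2_eigenvalue (fun y => potential a (y *m B)) mu].

Definition thresholds : set R :=
  \bigcup_(b in [set b | lt_index b (mb_1 M)]) spec_pp b.

Definition sphere : set E := [set omega | dot omega omega = 1].
Definition C_ a : set E := sphere `&` [set omega | omega \in X a].
Definition C'_ a : set E :=
  C_ a `\` \bigcup_(b in [set b | ~~ le_index b a]) C_ b.

(* The points of the compressed phase space dotT are pairs [(omega, xi)] with [omega]
   in C'_a and [xi] in X_a; since the C'_a are disjoint, [omega] determines
   [a]. *)
Definition stratum omega : I := xget (mb_0 M) [set a | C'_ a omega].

Definition phase_space : set (E * E) := sphere `*` setT.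

Definition compress p : E * E := (p.1, oproj (X (stratum p.1)) p.2).

Definition Sigma b lambda : set (E * E) :=
  [set p | [/\ C_ b p.1, p.2 \in X b & spec_pp b (lambda - dot p.2 p.2)]].

Definition dotSigma lambda : set (E * E) :=
  \bigcup_b (compress @` Sigma b lambda).

(* Open sets of the quotient topology of [compress : phase_space -> dotT]. *)
Definition dotT_open (U : set (E * E)) : Prop :=
  open (compress @^-1` U : set (subspace phase_space)).

Definition continuous_into_dotT J gamma : Prop :=
  forall U, dotT_open U -> open (gamma @^-1` U : set (subspace J)).

(* The vector field is the same formula on each [C_ b `*` X b]. *)
Definition ham_field p : E * E :=
  (2 *: (p.2 - dot p.1 p.2 *: p.1), 0).

(* The smooth functions on the closed submanifold [phase_space] are the
   restrictions of smooth functions on R^n x R^n, and [ham_field] is tangent to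
   [phase_space]. *)
Definition pi_invariant (f fpi : E * E -> R) : Prop :=
  smooth_on setT f /\ forall p, phase_space p -> f p = fpi (compress p).

(* The lower Dini derivatives of [h], seen as a function on [J], from the right
   ([right = true]) and from the left; they are +oo where [J] has no point on
   that side. *)
Definition dini (right : bool) J (h : R -> R) t0 : \bar R :=
  limf_einf (fun t => ((h t - h t0) / (t - t0))%:E)
    (within J (if right then t0^'+ else t0^'-)).

Definition broken_bichar lambda J gamma : Prop :=
  [/\ forall t, J t -> dotSigma lambda (gamma t),
      continuous_into_dotT J gamma &
      forall t0 (right : bool) f fpi a, J t0 -> pi_invariant f fpi ->
        C'_ a (gamma t0).1 ->
        (ereal_inf [set ('D_(ham_field p) f p)%:E | p in
           [set p | exists b, [/\ C_ a `<=` C_ b, Sigma b lambda p &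
                                  compress p = gamma t0]]]
         <= dini right J (fpi \o gamma) t0)%E].

(* Derivatives at the end points of [S] are one-sided. *)
Definition integral_curve (S : set R) (c : R -> E * E) : Prop :=
  forall t, S t ->
    (fun s => (s - t)^-1 *: (c s - c t)) @ within S t^' --> ham_field (c t).

Definition projected_integral_curve lambda (S : set R) gamma : Prop :=
  exists a (c : R -> E * E),
    [/\ forall t, S t -> Sigma a lambda (c t),
        integral_curve S c &
        forall t, S t -> gamma t = compress (c t)].

Definition piecewise_projected lambda J gamma : Prop :=
  exists (k : nat) (t : nat -> R),
    [/\ forall j, (j <= k)%N -> J (t j),
        forall j, (j < k)%N -> t j < t j.+1 &
    [/\ projected_integral_curve lambda (J `&` `]-oo, t 0%N]) gamma,
        forall j, (j < k)%N ->
          projected_integral_curve lambda `[t j, t j.+1] gamma &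
        projected_integral_curve lambda (J `&` `[t k, +oo[) gamma]].

End ManyBodyTheory.

(* Main.v *)
(* Polynomial pi-invariant functions already carry all the information.  Along a
   broken bichar the component of the momentum tangent to the current stratum is
   locally constant, [om_a] solves an ODE, and [eta = om . ze] is nondecreasing with
   D eta >= 2 (|xi|^2 - eta^2) for some [xi] in the fibre, where [|xi|^2] takes
   finitely many values.

   Suppose [om] tends to a point of C'_a at an end of an interval (a point of J, or
   an end of J, possibly infinite).  Let [r = |om^a|] and let [p] be the radial
   momentum [(om^a . xi^a) / r].  The zero set of [r] is an interval, and where
   [r > 0] one has r' = 2 (p - eta r) and D p >= 2 (|xi^a|^2 - p^2) / r >= 0; since
   [|xi^a|^2] takes finitely many values and [r] tends to 0, [p] is eventually
   constant.  Then [xi^a] is radial, the direction of [om^a] is locally constant,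
   and the curve is a single integral curve near that end.  By time reversal this
   holds on both sides of each point, and compactness gives finitely many pieces
   on compact intervals.

   At an end of J outside J the convergence of [om] comes from finite length: with
   [u = sup eta - eta] one has |om'|^2 = 2 eta' >= c u on the pieces, so
   that [- C sqrt u - om . l] is eventually nondecreasing for every [l]. *)
From HB Require Import structures.
Require Import Defs.
From mathcomp Require Import all_boot all_order all_algebra ring lra.
From mathcomp Require Import all_classical all_reals all_analysis.
Set Implicit Arguments.
Unset Strict Implicit.
Unset Printing Implicit Defensive.
Import Order.TTheory GRing.Theory Num.Theory.
Import numFieldNormedType.Exports.
Local Open Scope classical_set_scope.
Local Open Scope ring_scope.

(** * Dini derivatives along an interval *)

Section Dini.
Context {R : realType}.
Implicit Types (J K : set R) (f g h : R -> R) (s t m c : R).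

(** The definition of a broken bicharacteristic only bounds Dini derivatives from below by an
    infimum over a fibre, and the momentum [xi] attached to a time is chosen with no regularity in
    time, so nothing can be integrated. All conclusions are drawn from a mean value inequality for
    such lower bounds. A lower bound becomes a derivative where the Hamilton derivative of a test
    function does not depend on the momentum in the fibre, since the negative of the function may
    then be tested too; this happens for [om . l] and, after localization, for [ze . l] with [l] in
    the stratum. A genuine inequality remains only for [eta], and [xi] is recovered where it
    degenerates: once [p] is constant, Cauchy-Schwarz is an equality. Discreteness of the thresholds
    enters through [lambda - |xi|^2], an eigenvalue of some H^b whose [X b] contains a unit vector,
    so that [b] is not the index 1. Time reversal is available because [eta] changes sign together
    with time, which keeps its lower bounds. *)

Definition slope h t s : R := (h s - h t) / (s - t).

(** Relative to [J]: two-sided at interior points, one-sided at end points, void when [t] is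
    isolated in [J]. *)
Variant dwithin J h t m : Prop :=
  DWithin of slope h t @ within J t^' --> m.

(* Being two-sided, this bounds both lower Dini derivatives from below. *)
Variant dlower J h t m : Prop :=
  DLower of forall e, 0 < e -> \forall s \near within J t^', m - e <= slope h t s.

Lemma slopeD f g t s : slope (fun x => f x + g x) t s = slope f t s + slope g t s.
Proof. by rewrite /slope -mulrDl; congr (_ / _); ring. Qed.

Lemma slopeN f t s : slope (fun x => - f x) t s = - slope f t s.
Proof. by rewrite /slope -mulNr; congr (_ / _); ring. Qed.

Lemma slopeM f g t s :
  slope (fun x => f x * g x) t s = slope f t s * g s + f t * slope g t s.
Proof. by rewrite /slope mulrAC (mulrA (f t)) -mulrDl; congr (_ / _); ring. Qed.

Lemma slopeK h t s : s != t -> h s = h t + slope h t s * (s - t).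
Proof. by move=> st; rewrite /slope divfK ?subr_eq0// addrC subrK. Qed.

Lemma near_dwithinP J t (P : R -> Prop) :
  (\forall s \near within J t^', P s) <->
  exists2 d, 0 < d & forall s, J s -> s != t -> `|s - t| < d -> P s.
Proof.
split.
  move=> /nbhs_ballP[d /= d0 H]; exists d => // s Js st sd.
  by apply: (H s) => //; rewrite /ball/= distrC.
move=> [d d0 H]; apply/nbhs_ballP; exists d => //= s; rewrite /ball/= distrC.
by move=> sd st Js; exact: H.
Qed.

Lemma cvg_dwithinP J t h m : h @ within J t^' --> m <->
  forall e, 0 < e -> exists2 d, 0 < d &
    forall s, J s -> s != t -> `|s - t| < d -> `|h s - m| < e.
Proof.
split=> [/cvgrPdist_lt H e e0|H].
  have /near_dwithinP[d d0 dH] := H e e0.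
  by exists d => // s *; rewrite distrC; exact: dH.
apply/cvgrPdist_lt => e e0; apply/near_dwithinP; have [d d0 dH] := H e e0.
by exists d => // s *; rewrite distrC; exact: dH.
Qed.

Lemma dwithin_cvg J h t m : dwithin J h t m -> h @ within J t^' --> h t.
Proof.
move=> [hm].
have tt : (fun s => s - t) @ within J t^' --> 0.
  apply/cvg_dwithinP => e e0; exists e => // s _ _.
  by rewrite subr0.
have : (fun s => h t + slope h t s * (s - t)) @ within J t^' --> h t + m * 0.
  by apply: cvgD; [exact: cvg_cst|exact: cvgM].
rewrite mulr0 addr0; apply: cvg_trans; apply: near_eq_cvg.
by apply/near_dwithinP; exists 1 => // s _ st _; rewrite -slopeK.
Qed.

Lemma dwithin_cst J c t : dwithin J (fun=> c) t 0.
Proof.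
split; rewrite (_ : slope _ _ = fun=> 0); first exact: cvg_cst.
by apply/funext => s; rewrite /slope subrr mul0r.
Qed.

Lemma dwithin_id J t : dwithin J id t 1.
Proof.
split; apply/cvg_dwithinP => e e0; exists 1 => // s _ st _.
by rewrite /slope divff ?subr_eq0// subrr normr0.
Qed.

Lemma dwithinD J f g t m n : dwithin J f t m -> dwithin J g t n ->
  dwithin J (fun x => f x + g x) t (m + n).
Proof.
move=> [fm] [gn]; split; rewrite (_ : slope _ _ = fun s => slope f t s + slope g t s).
  exact: cvgD.
by apply/funext => s; rewrite slopeD.
Qed.

Lemma dwithinN J f t m : dwithin J f t m -> dwithin J (fun x => - f x) t (- m).
Proof.
move=> [fm]; split; rewrite (_ : slope _ _ = fun s => - slope f t s).
  exact: cvgN.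
by apply/funext => s; rewrite slopeN.
Qed.

Lemma dwithinB J f g t m n : dwithin J f t m -> dwithin J g t n ->
  dwithin J (fun x => f x - g x) t (m - n).
Proof. by move=> fm gn; apply: dwithinD => //; exact: dwithinN. Qed.

Lemma dwithinM J f g t m n : dwithin J f t m -> dwithin J g t n ->
  dwithin J (fun x => f x * g x) t (m * g t + f t * n).
Proof.
move=> fm0 gn0; have [fm] := fm0; have [gn] := gn0; split.
rewrite (_ : slope _ _ = fun s => slope f t s * g s + f t * slope g t s).
  apply: cvgD; apply: cvgM => //; [exact: dwithin_cvg gn0|exact: cvg_cst].
by apply/funext => s; rewrite slopeM.
Qed.

Lemma dwithinZ J c f t m : dwithin J f t m -> dwithin J (fun x => c * f x) t (c * m).
Proof.
by move=> fm; have := dwithinM (dwithin_cst J c t) fm; rewrite mul0r add0r.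
Qed.

Lemma dwithin_sum (I : Type) (r : seq I) J (f : I -> R -> R) t (m : I -> R) :
  (forall i, dwithin J (f i) t (m i)) ->
  dwithin J (fun x => \sum_(i <- r) f i x) t (\sum_(i <- r) m i).
Proof.
move=> H; elim: r => [|i r IH].
  by rewrite big_nil; under eq_fun do rewrite big_nil; exact: dwithin_cst.
by rewrite big_cons; under eq_fun do rewrite big_cons; exact: dwithinD.
Qed.

(** The remainder of [f] at [c t] is o(|c s - c t|), and (c s - c t) / (s - t) is bounded near [t]
    because it converges; after division by s - t the error still tends to 0. *)
Lemma dwithin_diff (W : normedModType R) J (f : W -> R) (c : R -> W) t v :
  differentiable f (c t) ->
  (fun s => (s - t)^-1 *: (c s - c t)) @ within J t^' --> v ->
  dwithin J (f \o c) t ('d f (c t) v).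
Proof.
move=> df cv; have [dfc] := (@diff_locallyP R W R^o (c t) f).1 df => /eqaddoP fo.
pose q s := (s - t)^-1 *: (c s - c t).
have cq s : s != t -> c s - c t = (s - t) *: q s.
  by move=> st; rewrite /q scalerA divff ?subr_eq0// scale1r.
have dq : (fun s => 'd f (c t) (q s)) @ within J t^' --> 'd f (c t) v.
  by apply: cvg_comp cv _; exact: dfc.
have cc : (fun s => c s - c t) @ within J t^' --> (0 : W).
  have : (fun s => (s - t) *: q s) @ within J t^' --> 0 *: v.
    apply: cvgZ => //; apply/cvg_dwithinP => e e0; exists e => // s _ _.
    by rewrite subr0.
  rewrite scale0r; apply: cvg_trans; apply: near_eq_cvg.
  by apply/near_dwithinP; exists 1 => // s _ st _; rewrite -cq.
have /cvgr_norm_lt qb := cv.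
split; rewrite (_ : slope _ _ = fun s => 'd f (c t) (q s) +
    (slope (f \o c) t s - 'd f (c t) (q s))); last first.
  by apply/funext => s; rewrite addrC subrK.
rewrite -[X in _ --> X]addr0; apply: cvgD => //.
apply/cvgr0Pnorm_le => e e0.
pose B := `|v| + 1; have B0 : 0 < B by rewrite /B; have := normr_ge0 v; lra.
have eB : 0 < e / B by rewrite divr_gt0.
have near1 : \forall s \near within J t^', `|q s| < B.
  by apply: qb; rewrite /B; lra.
have near2 := cc _ (fo _ eB).
have near3 : \forall s \near within J t^', s != t.
  by apply/near_dwithinP; exists 1.
apply: filterS3 near1 near2 near3 => s qB.
rewrite /= !fctE /= subrK => fs st; move: fs; rewrite cq //.
have st0 : 0 < `|s - t| by rewrite normr_gt0 subr_eq0.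
rewrite linearZ /= normrZ => fs.
have -> : slope (f \o c) t s - 'd f (c t) (q s) =
    (f (c s) - (f (c t) + (s - t) *: ('d f (c t) (q s) : R^o))) / (s - t).
  rewrite /slope /= opprD addrA [RHS]mulrBl; congr (_ - _).
  by rewrite /GRing.scale /= mulrAC divff ?mul1r // subr_eq0.
rewrite normrM normfV ler_pdivrMr //; apply: le_trans fs _.
rewrite (mulrC `|s - t|) mulrA ler_pM2r // mulrAC ler_pdivrMr // ler_pM2l //.
exact: ltW.
Qed.

Lemma dwithin_comp J h (phi : R -> R) t m n : dwithin J h t m ->
  is_derive (h t) 1 phi n -> dwithin J (phi \o h) t (n * m).
Proof.
move=> hm [phid phin].
have dphi : differentiable (phi : R^o -> R^o) (h t) by apply/derivable1_diffP.
have := @dwithin_diff R^o J phi h t m dphi.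
rewrite -[X in 'd _ _ X]mulr1 -[m * 1]/(m *: (1 : R^o)) linearZ /= -deriveE //.
rewrite phin mulrC; apply; case: hm; rewrite /slope.
by under eq_fun do rewrite mulrC.
Qed.

End Dini.

(** * Mean value inequality for lower Dini bounds *)

Section DiniCalculus.
Context {R : realType}.
Implicit Types (J K : set R) (f g h : R -> R) (s t m n c d e : R).

(** The supremum of the set where [P] holds satisfies [P] by the limit clause and is [v] by the step
    clause. [P] may fail in between, so the limit clause is only given points with [P] arbitrarily
    close below [s]. *)
Lemma real_induction (P : R -> Prop) u v : u <= v -> P u ->
  (forall s, u <= s -> s < v -> P s -> exists s', [/\ s < s', s' <= v & P s']) ->
  (forall s, u < s -> s <= v ->
     (forall T, u <= T -> T < s -> exists x, [/\ T <= x, x < s & P x]) -> P s) ->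
  P v.
Proof.
move=> uv Pu step lim.
pose A := [set s | [/\ u <= s, s <= v & P s]].
have Au : A u by [].
have supA : has_sup A by split; [exists u|exists v => s []].
have us : u <= sup A by apply: sup_upper_bound.
have sv : sup A <= v by apply: ge_sup; [exists u|move=> s []].
have Ps : P (sup A).
  have [->//|us'] := eqVneq (sup A) u.
  have [PA|nPA] := pselect (P (sup A)); first by [].
  apply: lim => //; first by rewrite lt_neqAle eq_sym us' us.
  move=> T uT Ts; have [|x [ux xv Px] Tx] := @sup_adherent _ A (sup A - T) _ supA.
    by rewrite subr_gt0.
  exists x; split=> //; first by apply: ltW; move: Tx; rewrite subKr.
  rewrite lt_neqAle; apply/andP; split; last by apply: sup_upper_bound.
  by apply/eqP => xA; rewrite xA in Px.
have [<-//|sv'] := eqVneq (sup A) v.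
have [|s' [ss' s'v Ps']] := step (sup A) us _ Ps.
  by rewrite lt_neqAle sv'.
have : s' <= sup A by apply: sup_upper_bound => //; split=> //; lra.
by rewrite leNgt ss'.
Qed.

Lemma dlower_near J h t m e : dlower J h t m -> 0 < e ->
  exists2 d, 0 < d & forall s, J s -> s != t -> `|s - t| < d -> m - e <= slope h t s.
Proof. by move=> [H] e0; apply/near_dwithinP; exact: H. Qed.

Lemma dwithin_dlower J h t m n : dwithin J h t m -> n <= m -> dlower J h t n.
Proof.
move=> [/cvg_dwithinP H] nm; split=> e e0; have [d d0 dH] := H e e0.
apply/near_dwithinP; exists d => // s Js st sd.
by have := dH s Js st sd; rewrite ltr_norml => /andP[+ _]; lra.
Qed.

(** How derivatives arise from a one-sided definition: a test function and its negative with
    opposite bounds. *)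
Lemma dlower_dwithin J h t m : dlower J h t m ->
  dlower J (fun s => - h s) t (- m) -> dwithin J h t m.
Proof.
move=> [H1] [H2]; split; apply/cvg_dwithinP => e e0; have e20 : 0 < e / 2 by rewrite divr_gt0.
have [d1 d10 H1'] := (near_dwithinP _ _ _).1 (H1 _ e20).
have [d2 d20 H2'] := (near_dwithinP _ _ _).1 (H2 _ e20).
exists (Num.min d1 d2); first by rewrite lt_min d10.
move=> s Js st; rewrite lt_min => /andP[/(H1' _ Js st) + /(H2' _ Js st)].
rewrite slopeN => {}H1 {}H2; rewrite ltr_norml; apply/andP; lra.
Qed.

Lemma dlowerW J h t m n : n <= m -> dlower J h t m -> dlower J h t n.
Proof. by move=> nm [H]; split=> e e0; apply: filterS (H e e0) => s; lra. Qed.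

Lemma dlowerD J f g t m n : dlower J f t m -> dlower J g t n ->
  dlower J (fun s => f s + g s) t (m + n).
Proof.
move=> [fm] [gn]; split=> e e0; have e20 : 0 < e / 2 by rewrite divr_gt0.
by apply: filterS2 (fm _ e20) (gn _ e20) => s; rewrite slopeD; lra.
Qed.

(** Positivity of [g] near [t] preserves the inequality for the slope of [f] when it is multiplied
    by [g s]. *)
Lemma dlowerM J f g t m n : 0 < g t -> dlower J f t m -> dwithin J g t n ->
  dlower J (fun s => f s * g s) t (m * g t + f t * n).
Proof.
move=> g0 [fm] gn0; have [gn] := gn0; split=> e e0; pose e1 := e / 3 / g t.
have e10 : 0 < e1 by rewrite !divr_gt0.
have e1g : e1 * g t = e / 3 by rewrite divfK ?gt_eqF.
have gt_ := dwithin_cvg gn0.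
have c1 : (fun s => (m - e1) * g s) @ within J t^' --> (m - e1) * g t.
  by apply: cvgM => //; exact: cvg_cst.
have c2 : (fun s => f t * slope g t s) @ within J t^' --> f t * n.
  by apply: cvgM => //; exact: cvg_cst.
have e30 : 0 < e / 3 by rewrite divr_gt0.
have /cvgr_dist_lt /(_ _ e30) n1 := c1; have /cvgr_dist_lt /(_ _ e30) n2 := c2.
have /cvgr_gt /(_ _ g0) n3 := gt_.
near=> s.
have s1 : `|(m - e1) * g t - (m - e1) * g s| < e / 3 by near: s.
have s2 : `|f t * n - f t * slope g t s| < e / 3 by near: s.
have s3 : 0 < g s by near: s.
have s4 : m - e1 <= slope f t s by near: s; exact: fm.
rewrite slopeM; have : (m - e1) * g s <= slope f t s * g s by rewrite ler_pM2r.
move: s1 s2; rewrite !ltr_norml => /andP[_ s1] /andP[_ s2].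
by move: s1; rewrite !mulrBl e1g; lra.
Unshelve. all: by end_near. Qed.

Lemma dlower_local J K f g t m d : 0 < d ->
  (forall s, K s -> s != t -> `|s - t| < d -> J s /\ f s = g s) -> f t = g t ->
  dlower J f t m -> dlower K g t m.
Proof.
move=> d0 H ft [fm]; split=> e e0; have [d' d'0 H'] := (near_dwithinP _ _ _).1 (fm _ e0).
apply/near_dwithinP; exists (Num.min d d'); first by rewrite lt_min d0.
move=> s Ks st; rewrite lt_min => /andP[sd sd'].
have [Js fs] := H s Ks st sd.
by have := H' s Js st sd'; rewrite /slope fs ft.
Qed.

Lemma dwithin_local J K f g t m d : 0 < d ->
  (forall s, K s -> s != t -> `|s - t| < d -> J s /\ f s = g s) -> f t = g t ->
  dwithin J f t m -> dwithin K g t m.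
Proof.
move=> d0 H ft fm; apply: dlower_dwithin.
  exact: dlower_local d0 H ft (dwithin_dlower fm _).
apply: (@dlower_local J K (fun s => - f s)) d0 _ _ (dwithin_dlower (dwithinN fm) _) => //.
  by move=> s Ks st /(H _ Ks st)[? ->].
by rewrite ft.
Qed.

Lemma dlower_sub J K h t m : K `<=` J -> dlower J h t m -> dlower K h t m.
Proof. by move=> KJ; apply: (@dlower_local _ _ _ _ _ _ 1) => // s /KJ. Qed.

Lemma dwithin_sub J K h t m : K `<=` J -> dwithin J h t m -> dwithin K h t m.
Proof. by move=> KJ; apply: (@dwithin_local _ _ _ _ _ _ 1) => // s /KJ. Qed.

Lemma dlower_glue J h t m : dlower (J `&` [set s | s <= t]) h t m ->
  dlower (J `&` [set s | t <= s]) h t m -> dlower J h t m.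
Proof.
move=> [H1] [H2]; split=> e e0.
have [d1 d10 H1'] := (near_dwithinP _ _ _).1 (H1 _ e0).
have [d2 d20 H2'] := (near_dwithinP _ _ _).1 (H2 _ e0).
apply/near_dwithinP; exists (Num.min d1 d2); first by rewrite lt_min d10.
move=> s Js st; rewrite lt_min => /andP[s1 s2].
by have [ts|/ltW ts] := leP t s; [apply: H2'|apply: H1'].
Qed.

(** Real induction: slopes to the right of [s] advance the inequality, and slopes to the left of a
    limit point close it there, in place of continuity. *)
Lemma dlower_slope K h m : is_interval K -> (forall t, K t -> dlower K h t m) ->
  forall u v, K u -> K v -> u <= v -> m * (v - u) <= h v - h u.
Proof.
move=> iK H u v Ku Kv uv.
have Ks s : u <= s -> s <= v -> K s by move=> us sv; apply: (iK u v) => //; rewrite us.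
apply/ler_addgt0Pr => e e0; pose e1 := e / (1 + (v - u)).
have e10 : 0 < e1 by rewrite divr_gt0 //; lra.
have e1e : e1 * (v - u) <= e.
  by rewrite /e1 mulrAC ler_pdivrMr; [rewrite ler_pM2l //; lra|lra].
suff : (m - e1) * (v - u) <= h v - h u by move: e1e; rewrite mulrBl; lra.
apply: (@real_induction (fun s => (m - e1) * (s - u) <= h s - h u) u v) => //.
- by rewrite !subrr mulr0.
- move=> s us sv Ps.
  have [d d0 dH] := dlower_near (H s (Ks s us (ltW sv))) e10.
  exists (Num.min v (s + d / 2)).
  have s1 : s < Num.min v (s + d / 2) by rewrite lt_min sv /=; lra.
  have s2 : Num.min v (s + d / 2) <= s + d / 2 by rewrite ge_min lexx orbT.
  have s3 : Num.min v (s + d / 2) <= v by rewrite ge_min lexx.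
  move: (Num.min _ _) s1 s2 s3 => s' s1 s2 s3; split=> //.
  have Ks' : K s' by apply: Ks => //; lra.
  have sd : `|s' - s| < d by rewrite gtr0_norm; lra.
  have ss' : s' != s by rewrite gt_eqF.
  have := dH s' Ks' ss' sd; rewrite /slope ler_pdivlMr; last lra.
  suff : (m - e1) * (s' - u) = (m - e1) * (s' - s) + (m - e1) * (s - u) by lra.
  by ring.
- move=> s us sv lim.
  have [d d0 dH] := dlower_near (H s (Ks s (ltW us) sv)) e10.
  have [||x [sx xs Px]] := lim (Num.max u (s - d / 2)).
  + by rewrite le_max lexx.
  + by rewrite gt_max us /=; lra.
  move: sx; rewrite ge_max => /andP[ux sx].
  have Kx : K x by apply: Ks => //; lra.
  have xd : `|x - s| < d by rewrite ltr0_norm; lra.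
  have sx' : x != s by rewrite lt_eqF.
  have := dH x Kx sx' xd; rewrite /slope ler_ndivlMr; last lra.
  suff : (m - e1) * (x - u) = (m - e1) * (x - s) + (m - e1) * (s - u) by lra.
  by ring.
Qed.

Lemma dlower_nondecreasing K h : is_interval K -> (forall t, K t -> dlower K h t 0) ->
  forall u v, K u -> K v -> u <= v -> h u <= h v.
Proof.
move=> iK H u v Ku Kv uv; have := dlower_slope iK H Ku Kv uv.
by rewrite mul0r subr_ge0.
Qed.

Lemma dwithin0_constant K h : is_interval K -> (forall t, K t -> dwithin K h t 0) ->
  forall u v, K u -> K v -> h u = h v.
Proof.
move=> iK H; have mono u v : K u -> K v -> u <= v -> h u = h v.
  move=> Ku Kv uv; apply/eqP; rewrite eq_le; apply/andP; split.
    by apply: (dlower_nondecreasing iK) uv => // t Kt; exact: dwithin_dlower (H _ Kt) _.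
  rewrite -lerN2; apply: (@dlower_nondecreasing K (fun s => - h s)) uv => // t Kt.
  by apply: dwithin_dlower (dwithinN (H _ Kt)) _; rewrite oppr0.
by move=> u v Ku Kv; have [/mono->//|/ltW/mono->] := leP u v.
Qed.

End DiniCalculus.

(** * Gronwall estimates, derivatives at end points, reversal of time *)

Section Intervals.
Context {R : realType}.
Implicit Types (J K : set R) (f g h : R -> R) (s t m n c d e : R).

Lemma interval_adherent K t u d : is_interval K -> K t -> K u -> u != t -> 0 < d ->
  exists s, [/\ K s, s != t & `|s - t| < d].
Proof.
move=> iK Kt Ku ut d0; have [tu|ut'] := ltP t u.
  exists (Num.min u (t + d / 2)).
  have s1 : t < Num.min u (t + d / 2) by rewrite lt_min tu /=; lra.
  have s2 : Num.min u (t + d / 2) <= t + d / 2 by rewrite ge_min lexx orbT.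
  have s3 : Num.min u (t + d / 2) <= u by rewrite ge_min lexx.
  move: (Num.min _ _) s1 s2 s3 => s' s1 s2 s3; split.
  - by apply: (iK t u) => //; rewrite s3 ltW.
  - by rewrite gt_eqF.
  - by rewrite gtr0_norm; lra.
have {ut ut'}ut : u < t by rewrite lt_neqAle ut.
exists (Num.max u (t - d / 2)).
have s1 : Num.max u (t - d / 2) < t by rewrite gt_max ut /=; lra.
have s2 : t - d / 2 <= Num.max u (t - d / 2) by rewrite le_max lexx orbT.
have s3 : u <= Num.max u (t - d / 2) by rewrite le_max lexx.
move: (Num.max _ _) s1 s2 s3 => s' s1 s2 s3; split.
- by apply: (iK u t) => //; rewrite s3 ltW.
- by rewrite lt_eqF.
- by rewrite ltr0_norm; lra.
Qed.

(** The point [u] guarantees that there are slopes at [t] to compare: on a one-point set every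
    number is a derivative. *)
Lemma dlower_le_dwithin K h t u m n : is_interval K -> K t -> K u -> u != t ->
  dlower K h t m -> dwithin K h t n -> m <= n.
Proof.
move=> iK Kt Ku ut H1 H2; apply/ler_addgt0Pr => e e0.
have e20 : 0 < e / 2 by rewrite divr_gt0.
have H2' := dwithin_dlower (dwithinN H2) (lexx _).
have [d1 d10 dH1] := dlower_near H1 e20.
have [d2 d20 dH2] := dlower_near H2' e20.
have [|s [Ks st]] := @interval_adherent K t u (Num.min d1 d2) iK Kt Ku ut.
  by rewrite lt_min d10.
rewrite lt_min => /andP[/(dH1 _ Ks st) + /(dH2 _ Ks st)].
by rewrite slopeN; lra.
Qed.

Lemma is_intervalI J K : is_interval J -> is_interval K -> is_interval (J `&` K).
Proof.
move=> iJ iK x y [Jx Kx] [Jy Ky] z xzy; split; [exact: iJ xzy|exact: iK xzy].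
Qed.

Lemma is_interval_ge t : is_interval [set s | t <= s].
Proof. by move=> x y /= tx _ z /andP[xz _]; exact: le_trans xz. Qed.

Lemma is_interval_le t : is_interval [set s | s <= t].
Proof. by move=> x y /= _ yt z /andP[_ /le_trans]; exact. Qed.

Lemma is_interval_lt t : is_interval [set s | s < t].
Proof. by move=> x y /= _ yt z /andP[_ /le_lt_trans]; exact. Qed.

Lemma is_interval_gt t : is_interval [set s | t < s].
Proof. by move=> x y /= tx _ z /andP[xz _]; exact: lt_le_trans xz. Qed.

Lemma dwithin_expR J c t :
  dwithin J (fun s => expR (c * s)) t (c * expR (c * t)).
Proof.
have := dwithin_comp (dwithinZ c (@dwithin_id R J t)) (is_derive_expR (c * t)).
by rewrite mulr1 [expR _ * _]mulrC.
Qed.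

Lemma gronwall_le K h h' c : is_interval K ->
  (forall t, K t -> dwithin K h t (h' t)) -> (forall t, K t -> h' t <= c * h t) ->
  forall u v, K u -> K v -> u <= v -> h v * expR (- c * v) <= h u * expR (- c * u).
Proof.
move=> iK H H' u v Ku Kv uv; rewrite -lerN2.
apply: (@dlower_nondecreasing _ K (fun s => - (h s * expR (- c * s)))) uv => // t Kt.
apply: dwithin_dlower (dwithinN (dwithinM (H t Kt) (dwithin_expR K (- c) t))) _.
have := H' t Kt; have := expR_gt0 (- c * t); set E := expR _ => E0 le.
rewrite (_ : - _ = (c * h t - h' t) * E); last by ring.
by apply: mulr_ge0; [lra|exact: ltW].
Qed.

Lemma gronwall_ge K h h' c : is_interval K ->
  (forall t, K t -> dwithin K h t (h' t)) -> (forall t, K t -> c * h t <= h' t) ->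
  forall u v, K u -> K v -> u <= v -> h u * expR (- c * u) <= h v * expR (- c * v).
Proof.
move=> iK H H' u v Ku Kv uv; rewrite -lerN2 -!mulNr.
apply: (@gronwall_le K (fun s => - h s) (fun s => - h' s)) => // t Kt.
  exact: dwithinN (H t Kt).
by have := H' t Kt; rewrite mulrN; lra.
Qed.

(** The square [h * h] is nonnegative and has logarithmic rate [2 a], bounded by [2 c] on both
    sides; the two Gronwall lemmas cover [v] after and before [u]. *)
Lemma linear_ode_zero K h a c : is_interval K ->
  (forall t, K t -> dwithin K h t (a t * h t)) -> (forall t, K t -> `|a t| <= c) ->
  forall u v, K u -> K v -> h u = 0 -> h v = 0.
Proof.
move=> iK H ac u v Ku Kv hu.
have H2 t (Kt : K t) := dwithinM (H t Kt) (H t Kt).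
suff : h v * h v <= 0.
  by move=> hv; apply/eqP; rewrite -sqrf_eq0 eq_le sqr_ge0 andbT expr2.
have hh t : 0 <= h t * h t by rewrite -expr2 sqr_ge0.
have [uv|/ltW vu] := leP u v.
  have := @gronwall_le K (fun s => h s * h s) _ (2 * c) iK H2 _ u v Ku Kv uv.
  rewrite hu !mul0r pmulr_lle0 ?expR_gt0 //; apply => t Kt.
  have := ac t Kt; rewrite ler_norml => /andP[_ le].
  rewrite (_ : _ + _ = 2 * a t * (h t * h t)); last by ring.
  by apply: ler_wpM2r => //; lra.
have := @gronwall_ge K (fun s => h s * h s) _ (2 * - c) iK H2 _ v u Kv Ku vu.
rewrite hu !mul0r pmulr_lle0 ?expR_gt0 //; apply => t Kt.
have := ac t Kt; rewrite ler_norml => /andP[le _].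
rewrite (_ : a t * _ * _ + _ = 2 * a t * (h t * h t)); last by ring.
by apply: ler_wpM2r => //; lra.
Qed.

(** The mean value inequality on [K] compares [h] with slope [m] between [s] and any [x < e];
    continuity at [e] then lets [x] tend to [e]. *)
Lemma dwithin_endpoint J h F e m : is_interval J -> J e ->
  (forall t, J t -> t < e -> dwithin J h t (F t)) ->
  h @ within J e^' --> h e -> F @ within J e^' --> m ->
  dwithin (J `&` [set s | s <= e]) h e m.
Proof.
move=> iJ Je hF /cvg_dwithinP he /cvg_dwithinP Fm; split; apply/cvg_dwithinP => eps eps0.
have e20 : 0 < eps / 2 by rewrite divr_gt0.
have [d d0 dF] := Fm _ e20; exists d => // s [Js /= se] sne sd.
have {se}se : s < e by rewrite lt_neqAle sne.
have sd' : e - s < d by move: sd; rewrite distrC gtr0_norm ?subr_gt0.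
pose K := J `&` [set x | s <= x] `&` [set x | x < e].
have iK : is_interval K.
  by apply: is_intervalI; [apply: is_intervalI => //; exact: is_interval_ge|exact: is_interval_lt].
have Kd x : K x -> dwithin K h x (F x) /\ `|F x - m| < eps / 2.
  move=> [[Jx /= sx] /= xe]; split.
    by apply: dwithin_sub (hF x Jx xe) => y [[]].
  by apply: dF => //; [rewrite lt_eqF|rewrite ltr0_norm; lra].
have bnd x : K x -> `|h x - h s - m * (x - s)| <= eps / 2 * (x - s).
  move=> Kx; have [[Jx /= sx] /= xe] := Kx.
  have Ks : K s by split=> //; split=> //=.
  rewrite ler_norml; apply/andP; split.
    suff : (m - eps / 2) * (x - s) <= h x - h s by rewrite mulrBl; lra.
    apply: (dlower_slope iK) => // y Ky; have [hy] := Kd y Ky.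
    by rewrite ltr_norml => /andP[? ?]; apply: dwithin_dlower hy _; lra.
  suff : (- m - eps / 2) * (x - s) <= - h x - - h s by rewrite mulrBl; lra.
  apply: (@dlower_slope _ K (fun y => - h y)) => // y Ky; have [hy] := Kd y Ky.
  rewrite ltr_norml => /andP[? ?].
  by apply: dwithin_dlower (dwithinN hy) _; lra.
have : `|h e - h s - m * (e - s)| <= eps / 2 * (e - s).
  apply/ler_addgt0Pr => r r0.
  pose B := 1 + `|m|; have B1 : 1 <= B by rewrite /B lerDl.
  have r20 : 0 < r / 2 by rewrite divr_gt0.
  have [d1 d10 d1h] := he _ r20.
  (* Within this distance of [e] the term [m * (e - x)] costs less than [r / 2]; the other half pays
     for [h x - h e]. *)
  have rB : 0 < r / 2 / B by rewrite !divr_gt0 //; lra.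
  have se' : s != e by rewrite lt_eqF.
  have [||||x [[[Jx /= sx] /= xe] xne]] := @interval_adherent
     (J `&` [set x | s <= x] `&` [set x | x <= e]) e s (Num.min d1 (r / 2 / B)) _ _ _ se'.
  - apply: is_intervalI; last exact: is_interval_le.
    by apply: is_intervalI => //; exact: is_interval_ge.
  - by split; [split=> //=; exact: ltW|exact: lexx].
  - by split; [split=> //=|exact: ltW].
  - by rewrite lt_min d10.
  have {}xe : x < e by rewrite lt_neqAle xne.
  rewrite lt_min => /andP[/(d1h _ Jx xne) xh xB].
  have Kx : K x by split=> //; split.
  have bx := bnd x Kx.
  move: xB; rewrite ler0_norm ?subr_le0 ?(ltW xe) // ltr_pdivlMr; last lra.
  rewrite opprB => xB.
  have -> : h e - h s - m * (e - s) =
      - (h x - h e) + (h x - h s - m * (x - s)) + (- (m * (e - x))) by ring.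
  apply: le_trans (ler_normD _ _) _; rewrite normrN normrM.
  have := ler_normD (- (h x - h e)) (h x - h s - m * (x - s)); rewrite normrN.
  rewrite (gtr0_norm (_ : 0 < e - x)); last by rewrite subr_gt0.
  have : `|m| * (e - x) <= (e - x) * B.
    by rewrite mulrC ler_pM2l ?subr_gt0 // /B lerDr.
  have : eps / 2 * (x - s) <= eps / 2 * (e - s) by rewrite ler_pM2l //; lra.
  lra.
move=> bnd_e; rewrite /slope.
rewrite (_ : _ - m = (h e - h s - m * (e - s)) / (e - s)); last first.
  by field; rewrite !subr_eq0 sne eq_sym sne.
rewrite normrM normfV (gtr0_norm (_ : 0 < e - s)) ?subr_gt0 //.
rewrite ltr_pdivrMr ?subr_gt0 //; apply: le_lt_trans bnd_e _.
by rewrite ltr_pM2r ?subr_gt0 //; lra.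
Qed.

Lemma slopeNN h t s : slope (fun x => h (- x)) (- t) s = - slope h t (- s).
Proof. by rewrite /slope !opprK -mulrN -invrN opprB opprK (addrC t). Qed.

Lemma dwithinNN J h t m : dwithin J h t m ->
  dwithin (-%R @^-1` J) (fun s => h (- s)) (- t) (- m).
Proof.
move=> [/cvg_dwithinP H]; split; apply/cvg_dwithinP => e e0; have [d d0 dH] := H e e0.
exists d => // s Js st sd; have st' : - s != t by rewrite -eqr_oppLR in st *.
have sd' : `|- s - t| < d by rewrite -normrN opprD !opprK; move: sd; rewrite opprK.
by have := dH _ Js st' sd'; rewrite slopeNN -opprD normrN.
Qed.

(** Reversing time and changing the sign of the function leaves slopes unchanged. This is the
    behaviour of [eta], whose momentum is reversed with time. *)
Lemma dlowerNN J h t m : dlower J h t m ->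
  dlower (-%R @^-1` J) (fun s => - h (- s)) (- t) m.
Proof.
move=> H; split=> e e0; have [d d0 dH] := dlower_near H e0.
apply/near_dwithinP; exists d => // s Js st sd.
have st' : - s != t by rewrite -eqr_oppLR in st *.
have sd' : `|- s - t| < d by rewrite -normrN opprD !opprK; move: sd; rewrite opprK.
by have := dH _ Js st' sd'; rewrite slopeN slopeNN opprK.
Qed.

End Intervals.

(** * Radial dynamics near a stratum *)

Section AtEnd.
Context {R : realType}.
Implicit Types (J K : set R) (f g h : R -> R) (s t m n c d e l : R).

(** One filter for every kind of right end of [K]: attained, missing or infinite. *)
Definition at_end K : set_system R := filter_from K (fun T => K `&` [set s | T <= s]).

Lemma at_end_proper K : K !=set0 -> ProperFilter (at_end K).
Proof.
move=> [t0 Kt0]; apply: filter_from_proper; last by move=> t Kt; exists t; split=> //=.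
apply: filter_from_filter; first by exists t0.
move=> s t Ks Kt; exists (Num.max s t); first by rewrite /Num.max; case: ifP.
by move=> x [Kx /=]; rewrite ge_max => /andP[]; split.
Qed.

Lemma at_endP K (P : R -> Prop) :
  (\forall s \near at_end K, P s) <-> exists2 T, K T & forall s, K s -> T <= s -> P s.
Proof.
by split=> -[T KT H]; exists T => // s; [move=> Ks Ts|move=> [Ks Ts]]; exact: H.
Qed.

Lemma cvg_at_end J h t e l : is_interval J ->
  J t -> t < e -> J e -> h @ within J e^' --> l ->
  h @ at_end (J `&` [set s | s < e]) --> l.
Proof.
move=> iJ Jt te Je hl; apply: cvg_trans hl; apply: cvg_app => A.
move=> /(near_dwithinP _ _ A)[d d0 dA]; apply/at_endP.
have [|||||x [[Jx /= xe] xne xd]] := @interval_adherent _ (J `&` [set s | s <= e]) e t d.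
- by apply: is_intervalI => //; exact: is_interval_le.
- by split=> //=.
- by split=> //=; exact: ltW.
- by rewrite lt_eqF.
- by [].
have xe' : x < e by rewrite lt_neqAle xne.
exists x; first by split.
move=> s [Js /= se] xs; apply: dA => //; first by rewrite lt_eqF.
by move: xd; rewrite !ltr0_norm ?subr_lt0 //; lra.
Qed.

Lemma at_end_lt K h l x : K !=set0 -> h @ at_end K --> l -> l < x ->
  exists2 T, K T & forall s, K s -> T <= s -> h s < x.
Proof.
move=> K0 hl lx; have FF := at_end_proper K0.
by apply: (at_endP _ _).1; apply: (@cvgr_lt _ _ _ _ _ l hl).
Qed.

Lemma nondecreasing_cvg_at_end K h M : K !=set0 ->
  (forall s t, K s -> K t -> s <= t -> h s <= h t) ->
  (forall t, K t -> h t <= M) -> h @ at_end K --> sup (h @` K).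
Proof.
move=> [t0 Kt0] mono hM.
have supK : has_sup (h @` K).
  by split; [exists (h t0), t0|exists M => _ [t Kt <-]; exact: hM].
have FF : ProperFilter (at_end K) by apply: at_end_proper; exists t0.
apply/cvgrPdist_lt => e e0; apply/at_endP.
have [_ [T KT <-] Te] := sup_adherent e0 supK.
exists T => // s Ks Ts; have := mono _ _ KT Ks Ts.
have : h s <= sup (h @` K) by apply: sup_upper_bound => //; exists s.
by move=> h1 h2; rewrite ltr_norml; apply/andP; lra.
Qed.

End AtEnd.

Section Radial.
Context {R : realType}.
Implicit Types (K : set R) (N g eta k : R -> R) (ks : seq R) (B : R).

(* In the application [N = |om^a|^2], [g = om^a . xi^a] and [k = |xi^a|^2], where
   [x^a] is the component of [x] orthogonal to the stratum [X a].  After the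
   change of time [ds = 2 |x| dt] with [om = x / |x|], [|x^a|^2] is a convex
   function of [s]. *)
Record radial K N g eta k ks B : Prop := Radial {
  radial_interval : is_interval K;
  radial_N : forall t, K t -> dwithin K N t (4 * (g t - eta t * N t));
  radial_g : forall t, K t -> dlower K g t (2 * (k t - eta t * g t));
  radial_N0 : forall t, K t -> 0 <= N t;
  radial_CS : forall t, K t -> g t ^+ 2 <= k t * N t;
  radial_k : forall t, K t -> k t \in ks;
  radial_eta : forall t, K t -> `|eta t| <= B }.

Lemma radial_sub K K' N g eta k ks B : is_interval K' -> K' `<=` K ->
  radial K N g eta k ks B -> radial K' N g eta k ks B.
Proof.
move=> iK' sub [_ rN rg rN0 rCS rk re]; split=> //.
- by move=> t /sub Kt; apply: dwithin_sub sub _; exact: rN.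
- by move=> t /sub Kt; apply: dlower_sub sub _; exact: rg.
- by move=> t /sub; exact: rN0.
- by move=> t /sub; exact: rCS.
- by move=> t /sub; exact: rk.
- by move=> t /sub; exact: re.
Qed.

Section Positive.
Variables (K : set R) (N g eta k : R -> R) (ks : seq R) (B : R).
Hypotheses (rad : radial K N g eta k ks B) (N_gt0 : forall t, K t -> 0 < N t).
(* [p] is the radial momentum relative to the stratum. *)
Let r t := Num.sqrt (N t).
Let p t := g t / r t.

Lemma radial_r_gt0 t : K t -> 0 < r t.
Proof. by move=> Kt; rewrite sqrtr_gt0 N_gt0. Qed.

Lemma radial_r2 t : K t -> r t * r t = N t.
Proof. by move=> Kt; rewrite -expr2 sqr_sqrtr // ltW // N_gt0. Qed.

Lemma radial_pr t : K t -> g t = p t * r t.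
Proof. by move=> Kt; rewrite /p divfK // gt_eqF // radial_r_gt0. Qed.

Lemma radial_p2 t : K t -> p t ^+ 2 <= k t.
Proof.
move=> Kt; have := radial_CS rad Kt; have r0 := radial_r_gt0 Kt.
rewrite radial_pr // -radial_r2 // -expr2 exprMn ler_pM2r //.
by rewrite exprn_gt0.
Qed.

Lemma radial_dr t : K t -> dwithin K r t (2 * (p t - eta t * r t)).
Proof.
move=> Kt; have r0 := radial_r_gt0 Kt.
have := dwithin_comp (radial_N rad Kt) (is_derive1_sqrt (N_gt0 Kt)).
rewrite -/(r t) radial_pr // -radial_r2 //; congr dwithin.
by field; rewrite gt_eqF.
Qed.

(** In [p = g / r] the contributions of [eta] to [g'] and to [r'] cancel. *)
Lemma radial_dp t : K t -> dlower K p t (2 * (k t - p t ^+ 2) / r t).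
Proof.
move=> Kt; have r0 := radial_r_gt0 Kt.
have dV := dwithin_comp (radial_dr Kt)
  (@is_deriveV R id (r t) 1 1 (lt0r_neq0 r0) (is_derive_id (r t) 1)).
have rV0 : 0 < (r t)^-1 by rewrite invr_gt0.
have := @dlowerM R K g (fun x => (r x)^-1) t _ _ rV0 (radial_g rad Kt) dV; congr dlower.
rewrite radial_pr // /GRing.scale /=; field; rewrite gt_eqF //.
Qed.

Lemma radial_p_nondecreasing s t : K s -> K t -> s <= t -> p s <= p t.
Proof.
apply: dlower_nondecreasing; first exact: radial_interval rad.
move=> x Kx; apply: dlowerW (radial_dp Kx).
rewrite divr_ge0 ?(ltW (radial_r_gt0 Kx)) // mulr_ge0 // subr_ge0.
exact: radial_p2.
Qed.

Hypothesis K0 : K !=set0.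
Hypothesis N_cvg0 : N @ at_end K --> 0.

Lemma radial_r_cvg0 : r @ at_end K --> 0.
Proof.
by have := cvg_comp _ _ N_cvg0 (@sqrt_continuous R 0); rewrite sqrtr0.
Qed.

Lemma radial_r_small e : 0 < e -> exists2 T, K T & forall s, K s -> T <= s -> r s < e.
Proof.
exact: at_end_lt K0 radial_r_cvg0.
Qed.

(** A positive value of [p] persists by monotonicity, and as soon as [r] is small it makes [r]
    nondecreasing, so that [r] could not tend to 0. *)
Lemma radial_p_le0 t : K t -> p t <= 0.
Proof.
move=> Kt; rewrite leNgt; apply/negP => pt.
have B0 : 0 <= B by apply: le_trans (radial_eta rad Kt).
(* Below this value of [r] one has [eta r <= B r < p t <= p], hence [r' >= 0]; the [+ 1] covers
   [B = 0]. *)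
have e0 : 0 < p t / (B + 1) by rewrite divr_gt0 //; lra.
have [T0 KT0 rT0] := radial_r_small e0.
pose T := Num.max t T0; have KT : K T by rewrite /T /Num.max; case: ifP.
have tT : t <= T by rewrite le_max lexx.
have T0T : T0 <= T by rewrite le_max lexx orbT.
pose K' := K `&` [set s | T <= s].
have iK' : is_interval K'.
  by apply: is_intervalI; [exact: radial_interval rad|exact: is_interval_ge].
have [T1 KT1 rT1] := radial_r_small (radial_r_gt0 KT).
pose T2 := Num.max T T1; have KT2 : K T2 by rewrite /T2 /Num.max; case: ifP.
have TT2 : T <= T2 by rewrite le_max lexx.
have : r T <= r T2.
  apply: (dlower_nondecreasing iK') => //; last by split=> //=.
  move=> s [Ks /= Ts]; apply: dwithin_dlower (dwithin_sub _ (radial_dr Ks)) _.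
    by move=> x [].
  have := radial_eta rad Ks; have rs := radial_r_gt0 Ks; rewrite ler_norml => /andP[_ es].
  have ps : p t <= p s by apply: radial_p_nondecreasing => //; exact: le_trans Ts.
  have := rT0 s Ks (le_trans T0T Ts); rewrite ltr_pdivlMr; last lra.
  have : eta s * r s <= B * r s by rewrite ler_pM2r.
  by nra.
by rewrite leNgt rT1 // le_max lexx orbT.
Qed.

Lemma finite_gap (A : seq R) x : exists2 e, 0 < e & forall y, y \in A -> x < y -> x + e <= y.
Proof.
elim: A => [|y A [e e0 IH]]; first by exists 1.
have [yx|xy] := leP y x.
  exists e => // z; rewrite inE => /predU1P[->|/IH//].
  by rewrite ltNge yx.
exists (Num.min e (y - x)); first by rewrite lt_min e0 subr_gt0.
move=> z; rewrite inE => /predU1P[-> _|zA xz].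
  by rewrite -lerBrDl ge_min lexx orbT.
by apply: le_trans (IH z zA xz); rewrite lerD2l ge_min lexx.
Qed.

(* If [p] never reached its limit, [k - p^2] would be bounded below by the
   finiteness of [ks], and then [p + c ln r] would be nondecreasing for some
   [c > 0], although [r] tends to 0. *)
Lemma radial_p_eventually_constant :
  exists2 T, K T & forall s, K s -> T <= s -> p s = p T.
Proof.
have [T0 KT0] := K0; apply: contrapT => H.
have p0 := radial_p_le0.
have pcvg := nondecreasing_cvg_at_end K0 radial_p_nondecreasing p0.
set pe := sup _ in pcvg.
have supK : has_sup (p @` K) by split; [exists (p T0), T0|exists 0 => _ [t Kt <-]; exact: p0].
have p_le t : K t -> p t <= pe by move=> Kt; apply: sup_upper_bound => //; exists t.
have p_lt t : K t -> p t < pe.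
  move=> Kt; rewrite lt_neqAle p_le // andbT; apply/eqP => ptE; apply: H.
  exists t => // s Ks ts; apply/eqP; rewrite eq_le; apply/andP.
  by split; [rewrite ptE; exact: p_le|exact: radial_p_nondecreasing].
have pe0 : pe <= 0 by apply: ge_sup; [exists (p T0), T0|move=> _ [t Kt <-]; exact: p0].
have [e e0 gap] := finite_gap ks (pe ^+ 2).
have e20 : 0 < e / 2 by rewrite divr_gt0.
have p2cvg : (fun t => p t * p t) @ at_end K --> pe * pe.
  have FF := at_end_proper K0; exact: (cvgM pcvg pcvg).
have pe2 : pe * pe < pe ^+ 2 + e / 2 by rewrite expr2 ltrDl.
have [T1 KT1 pT1] : exists2 T, K T & forall s, K s -> T <= s -> p s * p s < pe ^+ 2 + e / 2.
  exact: at_end_lt K0 p2cvg pe2.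
have [T2 KT2 rT2] := radial_r_small ltr01.
pose T := Num.max T1 T2; have KT : K T by rewrite /T /Num.max; case: ifP.
have T1T : T1 <= T by rewrite le_max lexx.
have T2T : T2 <= T by rewrite le_max lexx orbT.
pose K' := K `&` [set s | T <= s].
have iK' : is_interval K'.
  by apply: is_intervalI; [exact: radial_interval rad|exact: is_interval_ge].
have B0 : 0 <= B by apply: le_trans (radial_eta rad KT).
(* Where [r < 1], [r' >= - C]. With [c = e / C] the loss [c C] from the logarithm is exactly [e],
   which the gain [2 (k - p^2) >= e] compensates. The [+ 1] makes [C] positive. *)
pose C := 2 * (B - p T) + 1; have C0 : 0 < C by rewrite /C; have := p0 _ KT; lra.
pose c := e / C; have c0 : 0 < c by rewrite divr_gt0.
pose h s := p s + c * ln (r s).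
have mono s : K s -> T <= s -> h T <= h s.
  move=> Ks Ts; apply: (dlower_nondecreasing iK') => //; last by split=> //=.
  move=> {Ks Ts}s [Ks /= Ts]; apply: (@dlower_sub _ K) => [x []//|].
  have rs := radial_r_gt0 Ks.
  have dl := dwithinZ c (dwithin_comp (radial_dr Ks) (is_derive1_ln rs)).
  apply: dlowerW (dlowerD (radial_dp Ks) (dwithin_dlower dl (lexx _))).
  have kps : e / 2 <= k s - p s ^+ 2.
    have := pT1 s Ks (le_trans T1T Ts); rewrite -expr2 => ps2.
    (* As [p s < pe <= 0], [k s >= p s ^+ 2 > pe ^+ 2]; the next possible value of [k] lies at least
       [e] higher. *)
    suff : pe ^+ 2 + e <= k s by lra.
    apply: gap; first exact: radial_k rad _ Ks.
    apply: lt_le_trans (radial_p2 Ks).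
    by have := p_lt s Ks; nra.
  have rs1 := rT2 s Ks (le_trans T2T Ts).
  have pTs : p T <= p s by apply: radial_p_nondecreasing.
  have := radial_eta rad Ks; rewrite ler_norml => /andP[_ es].
  have dr : - C <= 2 * (p s - eta s * r s).
    have : eta s * r s <= B * r s by rewrite ler_pM2r.
    by rewrite /C; nra.
  rewrite [leRHS](_ : _ =
    (2 * (k s - p s ^+ 2) + c * (2 * (p s - eta s * r s))) / r s); last first.
    by field; rewrite gt_eqF.
  apply: divr_ge0; last exact: ltW.
  have cC : c * C = e by rewrite /c divfK // gt_eqF.
  have : c * - C <= c * (2 * (p s - eta s * r s)) by rewrite ler_pM2l.
  by rewrite mulrN cC; lra.
(* Beyond [T3] the logarithm alone puts [c * ln (r s)] below [h T], and [p <= 0] cannot make up for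
   it. *)
have [T3 KT3 rT3] := radial_r_small (expR_gt0 (h T / c)).
pose T4 := Num.max T T3; have KT4 : K T4 by rewrite /T4 /Num.max; case: ifP.
have TT4 : T <= T4 by rewrite le_max lexx.
have : ln (r T4) < h T / c.
  rewrite -(expRK (h T / c)) ltr_ln ?posrE ?expR_gt0 ?radial_r_gt0 //.
  by apply: rT3 => //; rewrite le_max lexx orbT.
rewrite ltr_pdivlMr // mulrC; have := mono T4 KT4 TT4; rewrite /h.
by have := p0 T4 KT4; lra.
Qed.

End Positive.

End Radial.

(** * The zero set of the distance to a stratum *)

Section ZeroSet.
Context {R : realType}.
Implicit Types (J K : set R) (h N g eta k : R -> R) (s t u v e B : R) (ks : seq R).

Lemma last_zero K h h' u v : is_interval K -> (forall t, K t -> dwithin K h t (h' t)) ->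
  K u -> K v -> u <= v -> h u = 0 -> exists a, [/\ u <= a, a <= v, h a = 0 &
    forall s, a < s -> s <= v -> h s != 0].
Proof.
move=> iK hh Ku Kv uv hu.
pose A := [set s | [/\ u <= s, s <= v & h s = 0]].
have supA : has_sup A by split; [exists u|exists v => s []].
have ua : u <= sup A by apply: sup_upper_bound.
have av : sup A <= v by apply: ge_sup; [exists u|move=> s []].
exists (sup A); split=> //; last first.
  move=> s as_ sv; apply/eqP => hs; have : s <= sup A.
    by apply: sup_upper_bound => //; split=> //; apply: le_trans (ltW as_).
  by rewrite leNgt as_.
have Ka : K (sup A) by apply: (iK u v) => //; rewrite ua.
apply/eqP; apply: contraT => ha0.
have ha1 : 0 < `|h (sup A)| by rewrite normr_gt0.
have /cvg_dwithinP /(_ _ ha1) [d d0 dh] := dwithin_cvg (hh _ Ka).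
have [x Ax] := sup_adherent d0 supA.
have [ux xv hx] := Ax => dx.
have xa : x <= sup A by apply: sup_upper_bound.
have xne : x != sup A by apply: contra ha0 => /eqP <-; apply/eqP.
have Kx : K x by apply: (iK u v) => //; rewrite ux.
have := dh x Kx xne; rewrite hx sub0r normrN ltxx; apply.
by rewrite ler0_norm ?subr_le0 //; lra.
Qed.

Lemma first_zero K h h' u v : is_interval K -> (forall t, K t -> dwithin K h t (h' t)) ->
  K u -> K v -> u <= v -> h v = 0 -> exists b, [/\ u <= b, b <= v, h b = 0 &
    forall s, u <= s -> s < b -> h s != 0].
Proof.
move=> iK hh Ku Kv uv hv.
have iK' : is_interval (-%R @^-1` K).
  by move=> x y Kx Ky z /andP[xz zy]; apply: (iK (- y) (- x)) => //; rewrite !lerN2 zy.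
have [||||| a [va au ha H]] := @last_zero (-%R @^-1` K) (fun s => h (- s))
  (fun s => - h' (- s)) (- v) (- u) iK'.
- by move=> t Kt; rewrite -{1}(opprK t); apply: dwithinNN; exact: hh.
- by rewrite /= opprK.
- by rewrite /= opprK.
- by rewrite lerN2.
- by rewrite opprK.
exists (- a); split=> //; [by rewrite lerNr|by rewrite lerNl|].
by move=> s us sa; rewrite -(opprK s); apply: H; [rewrite ltrNr|rewrite lerN2].
Qed.

(* On a gap between two zeros of [N], [g <= 0] because [N] returns to 0 at the
   right end, so Gronwall from the left end forces [N = 0]. *)
Lemma radial_zero_convex K N g eta k ks B t1 t2 t : radial K N g eta k ks B ->
  K t1 -> K t2 -> t1 <= t -> t <= t2 -> N t1 = 0 -> N t2 = 0 -> N t = 0.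
Proof.
move=> rad K1 K2 t1t tt2 N1 N2; apply/eqP; apply: contraT => Nt.
have iK := radial_interval rad.
have Kt : K t by apply: (iK t1 t2) => //; rewrite t1t.
have B0 : 0 <= B by apply: le_trans (radial_eta rad Kt).
have [a [t1a at_ Na Ha]] := last_zero iK (radial_N rad) K1 Kt t1t N1.
have [b [tb bt2 Nb Hb]] := first_zero iK (radial_N rad) Kt K2 tt2 N2.
have {}at_ : a < t by rewrite lt_neqAle at_ andbT; apply: contra Nt => /eqP <-; apply/eqP.
have {}tb : t < b by rewrite lt_neqAle tb andbT; apply: contra Nt => /eqP ->; apply/eqP.
have Ka : K a by apply: (iK t1 t) => //; rewrite t1a ltW.
have Kb : K b by apply: (iK t t2) => //; rewrite bt2 ltW.
pose J := K `&` [set s | a < s].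
pose K' := J `&` [set s | s < b].
have iJ : is_interval J by apply: is_intervalI => //; exact: is_interval_gt.
have iK' : is_interval K' by apply: is_intervalI => //; exact: is_interval_lt.
have K'K : K' `<=` K by move=> s [[]].
have rad' : radial K' N g eta k ks B by exact: radial_sub rad.
have N_gt0 s : K' s -> 0 < N s.
  move=> [[Ks /= as_] sb]; rewrite lt_neqAle eq_sym (radial_N0 rad Ks) andbT.
  by have [st|ts] := leP s t; [exact: Ha|apply: Hb => //; exact: ltW].
have K't : K' t by split.
have g_le0 s : K' s -> g s <= 0.
  move=> K's; have r0 := radial_r_gt0 N_gt0 K's.
  rewrite (radial_pr g N_gt0 K's) pmulr_lle0 //.
  apply: (radial_p_le0 rad' N_gt0) => //; first by exists t.
  apply: (@cvg_at_end _ J N t b) => //; first by split=> //; exact: lt_trans tb.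
  rewrite -Nb; apply: cvg_trans (dwithin_cvg (radial_N rad Kb)).
  by apply: cvg_app; apply: within_subset => // s' [].
pose K'' := K `&` [set s | a <= s] `&` [set s | s <= t].
have iK'' : is_interval K''.
  apply: is_intervalI; last exact: is_interval_le.
  by apply: is_intervalI => //; exact: is_interval_ge.
have Nt0 : N t * expR (- (4 * B) * t) <= N a * expR (- (4 * B) * a).
  apply: (@gronwall_le _ K'' N (fun s => 4 * (g s - eta s * N s)) (4 * B) iK'').
  - by move=> s [[Ks _] _]; apply: dwithin_sub (radial_N rad Ks) => x [[]].
  - move=> s [[Ks /= as_] /= st]; rewrite -mulrA ler_pM2l //.
    have := radial_eta rad Ks; rewrite ler_norml => /andP[es _].
    have : - B * N s <= eta s * N s by rewrite ler_wpM2r // (radial_N0 rad).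
    have : g s <= 0.
      (* The sign of [g] is known only inside the gap; at its left end [N = 0], and Cauchy-Schwarz
         gives [g = 0]. *)
      have [sa|sa] := eqVneq s a.
        have := radial_CS rad Ka; rewrite sa Na mulr0 => ga.
        suff /eqP -> : g a == 0 by [].
        by rewrite -sqrf_eq0 eq_le ga sqr_ge0.
      apply: g_le0; split; last exact: le_lt_trans tb.
      by split=> //=; rewrite lt_neqAle eq_sym sa.
    by lra.
  - by split=> /=; [split=> /=|exact: ltW].
  - by split=> /=; [split=> //=; exact: ltW|].
  - exact: ltW.
move: Nt0; rewrite Na mul0r pmulr_lle0 ?expR_gt0 // => Nt0.
by rewrite -(negbTE Nt) eq_le Nt0 (radial_N0 rad).
Qed.

(** If zeros of [N] occur arbitrarily late, convexity of the zero set fills the gaps between them.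
    Otherwise [N] is positive from some time on and the radial momentum freezes. *)
Lemma radial_dichotomy K N g eta k ks B : radial K N g eta k ks B ->
  K !=set0 -> N @ at_end K --> 0 -> exists2 T, K T &
    (forall s, K s -> T <= s -> N s = 0) \/
    (forall s, K s -> T <= s -> 0 < N s /\
       g s / Num.sqrt (N s) = g T / Num.sqrt (N T)).
Proof.
move=> rad K0 Ncvg; have iK := radial_interval rad.
have [[t1 [K1 N1 H]]|H] := pselect (exists t1, [/\ K t1, N t1 = 0 &
    forall s, K s -> exists u, [/\ K u, s <= u & N u = 0]]).
  exists t1 => //; left=> s Ks t1s; have [u [Ku su Nu]] := H s Ks.
  exact: radial_zero_convex rad K1 Ku t1s su N1 Nu.
have [T KT NT] : exists2 T, K T & forall s, K s -> T <= s -> N s != 0.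
  apply: contrapT => H'; apply: H.
  have H2 s : K s -> exists u, [/\ K u, s <= u & N u = 0].
    move=> Ks; apply: contrapT => H3; apply: H'; exists s => // u Ku su.
    by apply/eqP => Nu; apply: H3; exists u.
  have [t0 Kt0] := K0; have [u [Ku _ Nu]] := H2 t0 Kt0.
  by exists u.
pose K' := K `&` [set s | T <= s].
have iK' : is_interval K' by apply: is_intervalI => //; exact: is_interval_ge.
have rad' : radial K' N g eta k ks B by apply: radial_sub rad => // s [].
have N_gt0 s : K' s -> 0 < N s.
  by move=> [Ks Ts]; rewrite lt_neqAle eq_sym NT // (radial_N0 rad).
have Ncvg' : N @ at_end K' --> 0.
  apply: cvg_trans Ncvg; apply: cvg_app => A /at_endP[U KU UA].
  apply/at_endP; exists (Num.max U T).
    by split; [rewrite /Num.max; case: ifP|rewrite /= le_max lexx orbT].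
  by move=> s [Ks _]; rewrite ge_max => /andP[Us _]; exact: UA.
have [|T' [KT' TT'] pT'] := radial_p_eventually_constant rad' N_gt0 _ Ncvg'.
  by exists T; split=> //=.
exists T' => //; right=> s Ks T's.
have K's : K' s by split=> //; exact: le_trans T's.
by split; [exact: N_gt0|exact: pT'].
Qed.

End ZeroSet.

(** * Orthogonal projections and strata *)

Section Dot.
Context {R : realType} {n : nat}.
Local Notation E := 'rV[R]_n.
Implicit Types (x y z l u v w : E) (U V : {vspace E}).

Lemma dotC x y : dot x y = dot y x.
Proof. by apply: eq_bigr => i _; rewrite mulrC. Qed.

Lemma dotDl x y z : dot (x + y) z = dot x z + dot y z.
Proof. by rewrite linearDl. Qed.

Lemma dotBl x y z : dot (x - y) z = dot x z - dot y z.
Proof. by rewrite linearBl. Qed.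

Lemma dotZl a x z : dot (a *: x) z = a * dot x z.
Proof. by rewrite linearZl. Qed.

Lemma dotBr x y z : dot z (x - y) = dot z x - dot z y.
Proof. by rewrite linearBr. Qed.

Lemma dotZr a x z : dot z (a *: x) = a * dot z x.
Proof. by rewrite linearZr. Qed.

Lemma dotNl x z : dot (- x) z = - dot x z.
Proof. by rewrite linearNl. Qed.

Lemma dotNr x z : dot z (- x) = - dot z x.
Proof. by rewrite linearNr. Qed.

Lemma dot0l x : dot 0 x = 0.
Proof. by rewrite linear0l. Qed.

Lemma dot0r x : dot x 0 = 0.
Proof. by rewrite linear0r. Qed.

Lemma dot_ge0 x : 0 <= dot x x.
Proof. by apply: sumr_ge0 => i _; rewrite -expr2 sqr_ge0. Qed.

Lemma dot_eq0 x : dot x x = 0 -> x = 0.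
Proof. by move=> x0; apply/eqP; apply: contraT => /dot_gt0; rewrite x0 ltxx. Qed.

Lemma dot_delta x i : dot x (delta_mx 0 i) = x 0 i.
Proof.
rewrite /dot (bigD1 i) //= mxE !eqxx mulr1 big1 ?addr0 // => j ji.
by rewrite mxE eqxx (negbTE ji) mulr0.
Qed.

Lemma dot_ext x y : (forall l, dot x l = dot y l) -> x = y.
Proof. by move=> H; apply/rowP => i; rewrite -!dot_delta. Qed.

Lemma dot_CS x y : dot x y ^+ 2 <= dot x x * dot y y.
Proof.
have [->|x0] := eqVneq x 0; first by rewrite !dot0l expr2 !mul0r.
have := dot_ge0 (dot x x *: y - dot x y *: x).
rewrite !dotBl !dotBr !dotZl !dotZr (dotC y x) => H.
rewrite -(ler_pM2l (dot_gt0 x0)) -subr_ge0.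
by apply: le_trans H _; rewrite le_eqVlt; apply/orP; left; apply/eqP; ring.
Qed.

Lemma oproj_dot U x l : l \in U -> dot (oproj U x) l = dot x l.
Proof.
move=> lU; have /mem_perp/(_ _ lU) := oproj_perp U x.
by rewrite dotBl => /eqP; rewrite subr_eq0 => /eqP.
Qed.

Lemma oproj_uniq U x z : z \in U -> (forall l, l \in U -> dot x l = dot z l) ->
  oproj U x = z.
Proof.
move=> zU H; apply/eqP; rewrite -subr_eq0; apply/eqP/dot_eq0.
have mU : oproj U x - z \in U by rewrite rpredB // oproj_mem.
by rewrite dotBl oproj_dot // H // subrr.
Qed.

Lemma oproj_id U x : x \in U -> oproj U x = x.
Proof. by move=> xU; exact: oproj_uniq. Qed.

Lemma oproj_adj U x l : dot (oproj U x) l = dot x (oproj U l).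
Proof.
by rewrite dotC -(oproj_dot l (oproj_mem U x)) dotC oproj_dot // oproj_mem.
Qed.

Lemma perpS U V : (U <= V)%VS -> (perp V <= perp U)%VS.
Proof.
move=> UV; apply/subvP => x /mem_perp xV; apply/mem_perp => y yU.
exact: xV (subvP UV y yU).
Qed.

(** Double orthogonality. It reduces membership in a subspace to the vanishing of scalars [dot x l],
    to which limits and linear differential equations apply. *)
Lemma memv_perpP U x : (forall l, l \in perp U -> dot x l = 0) -> x \in U.
Proof.
move=> H; suff <- : oproj U x = x by exact: oproj_mem.
apply/esym/eqP; rewrite -subr_eq0; apply/eqP/dot_eq0.
have pU := oproj_perp U x; rewrite dotBl H // dotC.
by have /mem_perp -> := pU; rewrite ?oproj_mem // subr0.
Qed.

Lemma perpS_eq U V : (perp V <= perp U)%VS = (U <= V)%VS.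
Proof.
apply/idP/idP => [VU|]; last exact: perpS.
apply/subvP => x xU; apply: memv_perpP => l /(subvP VU)/mem_perp lU.
by rewrite dotC lU.
Qed.

End Dot.

Section Stratum.
Context {R : realType} {n : nat} {I : finType} (M : manyBody R n I).
Local Notation E := 'rV[R]_n.
Local Notation X := (mb_X M).
Local Notation st := (stratum M).
Implicit Types (a b : I) (w : E).

Lemma le_indexE a b : le_index M a b = (X b <= X a)%VS.
Proof. exact: perpS_eq. Qed.

(** Closure of the family under intersections: the members containing [w] are intersected one after
    the other along the enumeration of [I]. *)
Lemma exists_minimal_stratum w : exists a, w \in X a /\ forall b, w \in X b -> (X a <= X b)%VS.
Proof.
suff [a [wa H]] : exists a, w \in X a /\ forall b, b \in enum I -> w \in X b -> (X a <= X b)%VS.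
  by exists a; split=> // b; apply: H; rewrite mem_enum.
elim: (enum I) => [|c s [a [wa IH]]]; first by exists (mb_0 M); rewrite mb_X_0 memvf.
have [wc|wc] := boolP (w \in X c); last first.
  exists a; split=> // b; rewrite inE => /predU1P[->|/IH//].
  by rewrite (negbTE wc).
have [d dE] := mb_X_cap M a c.
exists d; rewrite dE memv_cap wa wc; split=> // b; rewrite inE => /predU1P[-> _|bs wb].
  exact: capvSr.
by apply: subv_trans (IH b bs wb); exact: capvSl.
Qed.

(** [le_index] reverses inclusion of the subspaces, so the points removed from [C_ a] are those
    lying in a member that does not contain [X a]. *)
Lemma C'_P a w : dot w w = 1 ->
  C'_ M a w <-> w \in X a /\ forall b, w \in X b -> (X a <= X b)%VS.
Proof.
move=> w1; split=> [[[_ wa] H]|[wa H]].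
  split=> // b wb; rewrite -le_indexE; apply: contraT => ba.
  by exfalso; apply: H; exists b.
by split=> // -[b /= ba [_ /= /H]]; rewrite -le_indexE (negbTE ba).
Qed.

Lemma C'_stratum w : dot w w = 1 -> C'_ M (st w) w.
Proof.
move=> w1; have [a aP] := exists_minimal_stratum w.
exact: (@xgetI _ (mb_0 M) [set a | C'_ M a w] a ((C'_P a w1).2 aP)).
Qed.

Lemma stratum_mem w : dot w w = 1 -> w \in X (st w).
Proof. by move=> w1; have /(C'_P _ w1)[] := C'_stratum w1. Qed.

Lemma stratum_min w b : dot w w = 1 -> w \in X b -> (X (st w) <= X b)%VS.
Proof. by move=> w1; have /(C'_P _ w1)[_] := C'_stratum w1; exact. Qed.

(** A member [X b] missing [w] is separated from it by [l], the component of [w] orthogonal to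
    [X b]: [w . l > 0] persists nearby, while [l] vanishes on [X b]. As [I] is finite this holds for
    all [b] at once, so strata can only grow near [w]. *)
Lemma near_stratum (F : set_system R) (om : R -> E) w : Filter F ->
  (forall l, (fun s => dot (om s) l) @ F --> dot w l) ->
  \forall s \near F, forall b, om s \in X b -> w \in X b.
Proof.
move=> FF H; apply: filter_forall => b.
have [wb|wb] := boolP (w \in X b); first by apply: nearW.
pose l := w - oproj (X b) w.
have l0 : 0 < dot w l.
  rewrite (_ : dot w l = dot l l).
    by apply: dot_gt0; rewrite subr_eq0; apply: contra wb => /eqP ->; exact: oproj_mem.
  have /mem_perp lp := oproj_perp (X b) w.
  by rewrite /l dotBl (dotC (oproj _ w)) lp ?oproj_mem // subr0.
have /cvgr_gt /(_ _ l0) := H l; apply: filterS => s + sb.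
have /mem_perp lp := oproj_perp (X b) w.
by rewrite dotC lp // ltxx.
Qed.

End Stratum.

(** * Kinematics *)

Section VectorCurves.
Context {R : realType} {n : nat}.
Local Notation E := 'rV[R]_n.
Implicit Types (K : set R) (u : R -> E) (v l : E) (t : R).

(** The weak form lets the scalar calculus apply and moves projections onto the test vector. *)
Definition vdwithin (K : set R) u t v := forall l, dwithin K (fun s => dot (u s) l) t (dot v l).

Lemma vdwithin_dot_self K u t v : vdwithin K u t v ->
  dwithin K (fun s => dot (u s) (u s)) t (2 * dot (u t) v).
Proof.
move=> H; rewrite mulr_sumr; apply: dwithin_sum => i.
have Hi : dwithin K (fun s => u s 0 i) t (v 0 i).
  by rewrite -(dot_delta v); under eq_fun do rewrite -dot_delta; exact: H.
have := dwithinM Hi Hi; congr dwithin; ring.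
Qed.

Lemma vdwithinD K u1 u2 t v1 v2 : vdwithin K u1 t v1 -> vdwithin K u2 t v2 ->
  vdwithin K (fun s => u1 s + u2 s) t (v1 + v2).
Proof.
move=> H1 H2 l; rewrite dotDl; under eq_fun do rewrite dotDl; exact: dwithinD.
Qed.

Lemma vdwithinZ K (r : R -> R) (u : E) t m : dwithin K r t m ->
  vdwithin K (fun s => r s *: u) t (m *: u).
Proof.
move=> H l; rewrite dotZl; under eq_fun do rewrite dotZl.
have := dwithinM H (dwithin_cst K (dot u l) t); congr dwithin; ring.
Qed.

End VectorCurves.

Section Kinematics.
Context {R : realType} {n : nat} {I : finType} (M : manyBody R n I) (lambda : R).
Local Notation E := 'rV[R]_n.
Local Notation X := (mb_X M).
Local Notation st := (stratum M).
Implicit Types (a b : I) (w z xi l : E) (J K : set R) (om ze : R -> E) (s t B : R).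

(** The momenta over which the infimum is taken at the point (w, z): for [w] in [C'_ a], the
    inclusion of [C_ a] in [C_ b] amounts to [w \in X b]. *)
Definition fibre w z xi := exists b, [/\ w \in X b, xi \in X b,
  spec_pp M b (lambda - dot xi xi) & oproj (X (st w)) xi = z].

(* What is used of a broken bicharacteristic [(om, ze)]; it is invariant under the
   time reversal [t |-> (om (- t), - ze (- t))]. *)
Record kinematic J om ze : Prop := Kinematic {
  kin_interval : is_interval J;
  kin_unit : forall t, J t -> dot (om t) (om t) = 1;
  kin_fibre : forall t, J t -> exists xi, fibre (om t) (ze t) xi /\
    dlower J (fun s => dot (om s) (ze s)) t (2 * (dot xi xi - dot (om t) (ze t) ^+ 2));
  kin_om : forall t l, J t -> l \in X (st (om t)) ->
    dwithin J (fun s => dot (om s) l) t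
      (2 * (dot (ze t) l - dot (om t) (ze t) * dot (om t) l));
  kin_ze : forall t l, J t -> l \in X (st (om t)) ->
    dwithin J (fun s => dot (ze s) l) t 0;
  kin_cvg : forall t l, J t ->
    (fun s => dot (om s) l) @ within J t^' --> dot (om t) l }.

Lemma kin_sub J K om ze : is_interval K -> K `<=` J ->
  kinematic J om ze -> kinematic K om ze.
Proof.
move=> iK KJ [iJ u f o z c]; split=> //.
- by move=> t /KJ; exact: u.
- by move=> t /KJ /f[xi [H1 H2]]; exists xi; split=> //; exact: dlower_sub H2.
- by move=> t l /KJ Jt lX; apply: dwithin_sub KJ _; exact: o.
- by move=> t l /KJ Jt lX; apply: dwithin_sub KJ _; exact: z.
- move=> t l /KJ Jt; apply: cvg_trans (c t l Jt); apply: cvg_app.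
  exact: within_subset.
Qed.

(* The Hamilton field has no [xi]-component, so that the lift has a constant
   momentum [xi]. *)
Definition segment (S : set R) om ze := exists b xi, forall t, S t ->
  [/\ om t \in X b, xi \in X b, spec_pp M b (lambda - dot xi xi),
      oproj (X (st (om t))) xi = ze t &
      vdwithin S om t (2 *: (xi - dot (om t) xi *: om t))].

Lemma segment_sub S S' om ze : S' `<=` S -> segment S om ze -> segment S' om ze.
Proof.
move=> sub [b [xi H]]; exists b, xi => t /sub St; have [h1 h2 h3 h4 h5] := H t St.
by split=> // l; apply: dwithin_sub sub _; exact: h5.
Qed.

Lemma fibre_dot w z xi l : dot w w = 1 -> fibre w z xi -> l \in X (st w) ->
  dot xi l = dot z l.
Proof. by move=> w1 [b [_ _ _ <-]] lX; rewrite oproj_dot. Qed.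

(** [w] lies in its own stratum, so pairing with [w] ignores the component of [xi] lost by
    compression. *)
Lemma fibre_eta w z xi : dot w w = 1 -> fibre w z xi -> dot w xi = dot w z.
Proof.
by move=> w1 f; rewrite !(dotC w) (fibre_dot w1 f) // stratum_mem.
Qed.

Lemma kin_near_stratum J om ze t : kinematic J om ze -> J t ->
  exists2 d, 0 < d & forall s, J s -> `|s - t| < d ->
    (X (st (om t)) <= X (st (om s)))%VS.
Proof.
move=> k Jt; have H := @near_stratum _ _ _ M _ om (om t) _ (fun l => @kin_cvg _ _ _ k t l Jt).
have [d d0 dH] := (near_dwithinP _ _ _).1 (H _).
exists d => // s Js sd; have [->//|st_] := eqVneq s t.
apply: stratum_min; first exact: kin_unit k _ Jt.
by apply: (dH s) => //; apply: stratum_mem; exact: kin_unit k _ Js.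
Qed.

Section Bounded.
Variable ks : seq R.
Hypothesis ks_fibre : forall w z xi, dot w w = 1 -> fibre w z xi -> dot xi xi \in ks.

(** With [S] the sum, [eta ^+ 2 <= |xi|^2 <= S] gives [|eta| <= 1 + S] without a square root or a
    maximum. *)
Definition momentum_bound : R := 1 + \sum_(x <- ks) `|x|.

Lemma mem_le_sum_norm x : x \in ks -> x <= \sum_(y <- ks) `|y|.
Proof.
elim: ks => [//|y A IH]; rewrite inE big_cons => /predU1P[->|/IH xA].
  by apply: le_trans (ler_norm _) _; rewrite lerDl sumr_ge0.
by apply: le_trans xA _; rewrite lerDr.
Qed.

Lemma eta_bound J om ze t : kinematic J om ze -> J t ->
  `|dot (om t) (ze t)| <= momentum_bound.
Proof.
move=> k Jt; have w1 := kin_unit k Jt; have [xi [f _]] := kin_fibre k Jt.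
have CS := dot_CS (om t) xi; rewrite w1 mul1r (fibre_eta w1 f) in CS.
have := mem_le_sum_norm (ks_fibre w1 f); move: (dot xi xi) CS => q CS.
rewrite /momentum_bound; move: (\sum_(_ <- _) _) => S qS.
have : dot (om t) (ze t) ^+ 2 <= S by exact: le_trans qS.
by rewrite ler_norml => H; apply/andP; split; nra.
Qed.

(* Gronwall keeps the curve in the subspace [X b] of its initial point. *)
Lemma constant_fibre_segment K om ze xi : kinematic K om ze ->
  (forall t, K t -> fibre (om t) (ze t) xi) ->
  (forall t, K t -> vdwithin K om t (2 *: (xi - dot (om t) xi *: om t))) ->
  segment K om ze.
Proof.
move=> k f d; have [[t0 Kt0]|K0] := pselect (K !=set0); last first.
  by exists (mb_0 M), 0 => t Kt; exfalso; apply: K0; exists t.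
have [b [wb xib sb _]] := f t0 Kt0; exists b, xi => t Kt.
split=> //; [|by have [b' []] := f t Kt|exact: d].
apply: memv_perpP => l /mem_perp lb.
apply: (@linear_ode_zero _ K (fun s => dot (om s) l)
  (fun s => - (2 * dot (om s) (ze s))) (2 * momentum_bound) _ _ _ t0 t) => //.
- exact: kin_interval k.
- move=> s Ks; have := d s Ks l; congr dwithin.
  rewrite dotZl dotBl dotZl (dotC xi) lb // (fibre_eta (kin_unit k Ks) (f s Ks)).
  by ring.
- move=> s Ks; rewrite normrN normrM ger0_norm // ler_pM2l //.
  exact: eta_bound k Ks.
- by rewrite dotC lb.
Qed.

End Bounded.
End Kinematics.

(** * Curves staying close to one stratum *)

Section NearStratum.
Context {R : realType} {n : nat} {I : finType} (M : manyBody R n I) (lambda : R).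
Local Notation E := 'rV[R]_n.
Local Notation X := (mb_X M).
Local Notation st := (stratum M).
Variable ks : seq R.
Hypothesis ks_fibre :
  forall w z xi : E, dot w w = 1 -> fibre M lambda w z xi -> dot xi xi \in ks.
Variables (K : set R) (om ze : R -> E) (a : I) (z : E).
Hypotheses (kin : kinematic M lambda K om ze)
  (near_a : forall t, K t -> (X a <= X (st (om t)))%VS)
  (za : z \in X a)
  (ze_z : forall t l, K t -> l \in X a -> dot (ze t) l = dot z l).
Hypothesis nondegenerate : forall t, K t -> exists2 u, K u & u != t.
Implicit Types (t s : R) (l xi : E).

Let eta t := dot (om t) (ze t).
Let y t := oproj (X a) (om t).
Let w t := om t - y t.
Let N t := dot (w t) (w t).
(** Written without [xi], hence a function of the curve alone; [fibre_g] identifies it with om^a .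
    xi^a for every [xi] in the fibre. *)
Let g t := eta t - dot (om t) z.
Let r t := Num.sqrt (N t).
Let p t := g t / r t.
Let theta t := (r t)^-1 *: w t.

Let ya t : y t \in X a. Proof. exact: oproj_mem. Qed.

Let w_perp t l : l \in X a -> dot (w t) l = 0.
Proof. by have /mem_perp := oproj_perp (X a) (om t); exact. Qed.

Let om_w t : dot (om t) (w t) = N t.
Proof. by rewrite /N {2}/w dotBl (dotC (y t)) w_perp // subr0. Qed.

Let fibre_z t xi l : K t -> fibre M lambda (om t) (ze t) xi -> l \in X a ->
  dot xi l = dot z l.
Proof.
move=> Kt f la; rewrite (fibre_dot (kin_unit kin Kt) f) ?ze_z //.
exact: subvP (near_a Kt) _ la.
Qed.

Let fibre_k t xi : K t -> fibre M lambda (om t) (ze t) xi ->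
  dot (xi - z) (xi - z) = dot xi xi - dot z z.
Proof.
by move=> Kt f; rewrite dotBl !dotBr (dotC z xi) (fibre_z Kt f za); ring.
Qed.

Let fibre_g t xi : K t -> fibre M lambda (om t) (ze t) xi -> dot (w t) (xi - z) = g t.
Proof.
move=> Kt f; rewrite dotBr (w_perp _ za) subr0 /w dotBl (dotC (y t)) (fibre_z Kt f (ya t)).
by rewrite (fibre_eta (kin_unit kin Kt) f) /g /eta (dotC z) oproj_dot.
Qed.

Let near_dy t : K t -> vdwithin K y t (2 *: (z - eta t *: y t)).
Proof.
move=> Kt l; under eq_fun do rewrite oproj_adj.
have la := oproj_mem (X a) l.
have := kin_om kin Kt (subvP (near_a Kt) _ la); congr dwithin.
by rewrite dotZl dotBl dotZl oproj_adj ze_z // -oproj_adj oproj_id.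
Qed.

(** Only the component [y] in [X a] is known to be differentiable; on the unit sphere [N] is a
    function of it. *)
Let NE s : K s -> N s = 1 - dot (y s) (y s).
Proof.
move=> Ks; rewrite -om_w dotBr (kin_unit kin Ks); congr (_ - _).
exact: esym (oproj_dot (om s) (ya s)).
Qed.

(** [om . z] has the exact derivative [2 (|z|^2 - eta (om . z))]; subtracting it from the bound for
    [eta] gives the bound for [g]. Cauchy-Schwarz is that for om^a and [xi - z], and [xi] is chosen
    separately at each time. *)
Lemma near_radial : exists xi : R -> E,
  (forall t, K t -> fibre M lambda (om t) (ze t) (xi t)) /\
  (forall t, K t -> dlower K eta t (2 * (dot (xi t) (xi t) - eta t ^+ 2))) /\
  radial K N g eta (fun t => dot (xi t) (xi t) - dot z z)
    [seq x - dot z z | x <- ks] (momentum_bound ks).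
Proof.
have /choice[xi H] : forall t, exists xi, K t -> fibre M lambda (om t) (ze t) xi /\
    dlower K eta t (2 * (dot xi xi - eta t ^+ 2)).
  move=> t; have [Kt|nKt] := pselect (K t); last by exists 0.
  by have [xi [f d]] := kin_fibre kin Kt; exists xi.
exists xi; split; first by move=> t /H[].
split; first by move=> t /H[].
have d1 t (Kt : K t) := vdwithin_dot_self (near_dy Kt).
split.
- exact: kin_interval kin.
- move=> t Kt; have := dwithinB (dwithin_cst K 1 t) (d1 t Kt).
  move=> /(@dwithin_local _ _ K _ N t _ 1 ltr01).
  rewrite -NE // => /(_ (fun s Ks _ _ => conj Ks (esym (NE Ks))) erefl).
  congr dwithin; rewrite dotZr dotBr dotZr /g NE // (dotC (y t)) -oproj_adj oproj_id //.
  by rewrite (dotC z); ring.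
- move=> t Kt; have [f de] := H t Kt.
  have dz := kin_om kin Kt (subvP (near_a Kt) _ za).
  have := dlowerD de (dwithin_dlower (dwithinN dz) (lexx _)); congr dlower.
  by rewrite ze_z // /g -/(eta t); ring.
- by move=> t _; exact: dot_ge0.
- move=> t Kt; have [f _] := H t Kt.
  by rewrite -(fibre_k Kt f) -(fibre_g Kt f) mulrC; exact: dot_CS.
- move=> t Kt; have [f _] := H t Kt; apply: map_f.
  exact: ks_fibre (kin_unit kin Kt) f.
- by move=> t Kt; exact (eta_bound ks_fibre kin Kt).
Qed.

(** On the stratum [eta = om . z] is differentiable with derivative [2 (|z|^2 - eta^2)]. Against the
    lower bound this gives [|xi|^2 <= |z|^2], and [|xi - z|^2 = |xi|^2 - |z|^2] then forces
    [xi = z]. *)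
Lemma on_stratum_segment : (forall t, K t -> N t = 0) -> segment M lambda K om ze.
Proof.
move=> N0; have [xi [f [de _]]] := near_radial.
have omy t : K t -> om t = y t by move=> /N0/dot_eq0/eqP; rewrite subr_eq0 => /eqP.
have etaz t : K t -> eta t = dot (om t) z.
  by move=> Kt; rewrite /eta dotC omy // ze_z // dotC.
have xiz t : K t -> xi t = z.
  move=> Kt; apply/eqP; rewrite -subr_eq0; apply/eqP/dot_eq0.
  apply/eqP; rewrite eq_le dot_ge0 andbT (fibre_k Kt (f t Kt)) subr_le0.
  have [u Ku ut] := nondegenerate Kt.
  have dz := kin_om kin Kt (subvP (near_a Kt) _ za).
  have dez : dlower K (fun s => dot (om s) z) t (2 * (dot (xi t) (xi t) - eta t ^+ 2)).
    by apply: (@dlower_local _ K K eta _ t _ 1 ltr01) (de t Kt) => [s Ks _ _|];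
      [split=> //; exact: etaz|exact: etaz].
  have := dlower_le_dwithin (kin_interval kin) Kt Ku ut dez dz.
  by rewrite ze_z // -/(eta t) -etaz // ler_pM2l // expr2 lerD2r.
apply: (constant_fibre_segment ks_fibre kin (xi := z)).
  by move=> t Kt; rewrite -(xiz t Kt); exact: f.
move=> t Kt l.
have := near_dy Kt l.
move=> /(@dwithin_local _ K K _ (fun s => dot (om s) l) t _ 1 ltr01).
rewrite -omy // => /(_ _ erefl); rewrite etaz //.
by apply=> s Ks _ _; split=> //; rewrite -omy.
Qed.

(** Constancy of [p] forces equality in Cauchy-Schwarz, so [xi - z] is [p] times the direction
    [theta] of om^a; once [theta] is constant, so is [xi]. *)
Lemma radial_constant_segment t0 : K t0 ->
  (forall t, K t -> 0 < N t) -> (forall t, K t -> p t = p t0) ->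
  segment M lambda K om ze.
Proof.
move=> K0 N_gt0 pc; have [xi [f [_ rad]]] := near_radial.
have r0 t : K t -> 0 < r t by exact: radial_r_gt0.
have rne t (Kt : K t) : r t != 0 by rewrite gt_eqF // r0.
have rr t : K t -> r t * r t = N t by exact: radial_r2.
have theta1 t : K t -> dot (theta t) (theta t) = 1.
  by move=> Kt; rewrite dotZl dotZr -/(N t) -rr //; field; exact: rne.
have theta_perp t l : l \in X a -> dot (theta t) l = 0.
  by move=> la; rewrite dotZl w_perp // mulr0.
have om_theta t : K t -> dot (om t) (theta t) = r t.
  by move=> Kt; rewrite dotZr om_w -rr //; field; exact: rne.
have xiE t : K t -> xi t = z + p t0 *: theta t.
  move=> Kt; apply/eqP; rewrite -subr_eq0 opprD addrA; apply/eqP/dot_eq0.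
  (* The derivative 0 of [p] dominates [2 (k - p^2) / r], while [k >= p^2] always holds. *)
  have kp : dot (xi t) (xi t) - dot z z = p t0 ^+ 2.
    apply/eqP; rewrite eq_le -(pc t Kt) (radial_p2 rad N_gt0 Kt) andbT.
    have [u Ku ut] := nondegenerate Kt.
    have dp0 : dwithin K p t 0.
      by apply: (@dwithin_local _ K K (fun=> p t0) _ t _ 1 ltr01) (dwithin_cst _ _ _)
        => [s Ks _ _|]; [split=> //; rewrite pc|rewrite pc].
    have := dlower_le_dwithin (kin_interval kin) Kt Ku ut (radial_dp rad N_gt0 Kt) dp0.
    by rewrite -/(r t) pmulr_lle0 ?invr_gt0 ?r0 // pmulr_rle0 // subr_le0.
  have := fibre_g Kt (f t Kt); have := fibre_k Kt (f t Kt); rewrite kp.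
  move: (xi t - z) => v vv wv.
  have thv : dot (theta t) v = p t0 by rewrite dotZl wv -(pc t Kt) mulrC.
  have th1 := theta1 t Kt; move: (theta t) thv th1 => th thv th1.
  by rewrite dotBl !dotBr vv !dotZl !dotZr (dotC v) thv th1; ring.
(* Near [t] all strata contain [l = theta t], so [om . l] and [r] solve the same equation
   [u' = 2 (p - eta u)] with the same value at [t]. Hence they agree, and the unit vectors [theta s]
   and [theta t] have inner product 1. *)
have theta_local t : K t -> exists2 d, 0 < d & forall s, K s -> `|s - t| < d ->
    theta s = theta t.
  move=> Kt; have [d d0 dst] := kin_near_stratum kin Kt; exists d => // s Ks sd.
  pose l := theta t.
  pose K1 := K `&` [set s | t - d < s] `&` [set s | s < t + d].
  have iK1 : is_interval K1.
    apply: is_intervalI; last exact: is_interval_lt.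
    by apply: is_intervalI; [exact: kin_interval kin|exact: is_interval_gt].
  have K1K : K1 `<=` K by move=> x [[]].
  have K1t : K1 t by split; [split=> //=; rewrite ltrBlDr ltrDl|rewrite /= ltrDl].
  have K1s : K1 s.
    move: sd; rewrite ltr_norml => /andP[? ?].
    by split; [split=> //=|]; rewrite /=; lra.
  have lst x : K1 x -> l \in X (st (om x)).
    move=> [[Kx /= tx] /= xt]; apply: subvP (dst x Kx _) _ _.
      by rewrite ltr_norml; apply/andP; split; lra.
    (* [theta t] is a multiple of [om t - y t]; both terms lie in the stratum of [om t], the second
       because that stratum contains [X a]. *)
    rewrite rpredZ // rpredB //; first by rewrite stratum_mem // (kin_unit kin).
    exact: subvP (near_a Kt) _ (ya t).
  have zel x : K1 x -> dot (ze x) l = p t0.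
    move=> K1x; rewrite (@dwithin0_constant _ K1 (fun s => dot (ze s) l) iK1 _ x t) //.
      rewrite -(fibre_dot (kin_unit kin Kt) (f t Kt)) ?xiE //; last exact: lst.
      by rewrite dotDl dotZl theta1 // mulr1 (dotC z) theta_perp // add0r.
    by move=> u K1u; apply: dwithin_sub (kin_ze kin (K1K _ K1u) (lst u K1u)).
  have v0 : r s - dot (om s) l = 0.
    apply: (@linear_ode_zero _ K1 (fun s => r s - dot (om s) l) (fun s => - (2 * eta s))
      (2 * momentum_bound ks) iK1 _ _ t s) => //.
    - move=> x K1x; have Kx := K1K _ K1x.
      have := dwithinB (radial_dr rad N_gt0 Kx) (kin_om kin Kx (lst x K1x)).
      move=> /(dwithin_sub K1K); congr dwithin.
      by rewrite -/(r x) -/(p x) (pc x Kx) zel // -/(eta x); ring.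
    - move=> x /K1K Kx; rewrite normrN normrM ger0_norm // ler_pM2l //.
      exact: (eta_bound ks_fibre kin Kx).
    - by rewrite om_theta // subrr.
  apply/eqP; rewrite -subr_eq0; apply/eqP/dot_eq0.
  rewrite dotBl !dotBr !theta1 // (dotC (theta t)).
  have -> : dot (theta s) (theta t) = 1.
    rewrite {1}/theta dotZl /w dotBl (dotC (y s)) theta_perp // subr0.
    by move/eqP: v0; rewrite subr_eq0 => /eqP <-; rewrite mulVf // rne.
  by ring.
have theta_const t : K t -> theta t = theta t0.
  move=> Kt; apply: dot_ext => l.
  apply: (@dwithin0_constant _ K (fun s => dot (theta s) l)) => //.
    exact: kin_interval kin.
  move=> x Kx; have [d d0 dH] := theta_local x Kx.
  by apply: (@dwithin_local _ K K (fun=> dot (theta x) l) _ x _ d d0) (dwithin_cst _ _ _)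
     => // s Ks _ sd; rewrite dH.
have omE t : K t -> om t = y t + r t *: theta t0.
  move=> Kt; rewrite -(theta_const t Kt) scalerA mulfV ?rne // scale1r.
  by rewrite addrC subrK.
pose xi0 := z + p t0 *: theta t0.
have xi0E t : K t -> xi t = xi0 by move=> Kt; rewrite xiE // theta_const.
have f0 t : K t -> fibre M lambda (om t) (ze t) xi0.
  by move=> Kt; rewrite -(xi0E t Kt); exact: f.
apply: (constant_fibre_segment ks_fibre kin f0) => t Kt l.
have := vdwithinD (near_dy Kt) (vdwithinZ (theta t0) (radial_dr rad N_gt0 Kt)) l.
move=> /(@dwithin_local _ K K _ (fun s => dot (om s) l) t _ 1 ltr01).
rewrite -omE // => /(_ _ erefl).
have -> : 2 *: (z - eta t *: y t) +
      2 * (g t / Num.sqrt (N t) - eta t * Num.sqrt (N t)) *: theta t0 =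
    2 *: (xi0 - dot (om t) xi0 *: om t).
  rewrite -/(r t) -/(p t) (pc t Kt) (fibre_eta (kin_unit kin Kt) (f0 t Kt)) -/(eta t).
  rewrite (omE t Kt) /xi0 -scalerA -scalerDr; congr (_ *: _).
  by rewrite scalerBl scalerDr (scalerA (eta t)) opprD addrACA.
by apply=> s Ks _ _; split=> //; rewrite -omE.
Qed.

End NearStratum.

(** * Curves converging at an end, and time reversal *)

Section EndSegment.
Context {R : realType} {n : nat} {I : finType} (M : manyBody R n I) (lambda : R).
Local Notation E := 'rV[R]_n.
Local Notation X := (mb_X M).
Local Notation st := (stratum M).
Local Notation kinematic := (kinematic M lambda).
Local Notation fibre := (fibre M lambda).
Local Notation segment := (segment M lambda).
Variable ks : seq R.
Hypothesis ks_fibre : forall w z xi : E, dot w w = 1 -> fibre w z xi -> dot xi xi \in ks.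
Implicit Types (J K S : set R) (om ze : R -> E) (t s e T d : R) (w l xi : E) (a b : I).

Lemma cvg_dot_self (F : set_system R) (FF : Filter F) (u : R -> E) w :
  (forall l, (fun s => dot (u s) l) @ F --> dot w l) ->
  (fun s => dot (u s) (u s)) @ F --> dot w w.
Proof.
move=> H; rewrite /dot; elim: (index_enum _) => [|i r IH].
  by rewrite big_nil; under eq_fun do rewrite big_nil; exact: cvg_cst.
rewrite big_cons; under eq_fun do rewrite big_cons.
have Hi : (fun s => u s 0 i) @ F --> w 0 i.
  by rewrite -(dot_delta w); under eq_fun do rewrite -dot_delta; exact: H.
by apply: cvgD => //; exact: cvgM.
Qed.

(** Close to the limit all strata contain [X a], the least member through [w]. So the
    [X a]-component of the momentum is a constant [z], and the squared distance [N] to [X a] tends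
    to 0 because [w] lies in [X a]. *)
Lemma end_segment K om ze w : kinematic K om ze -> K !=set0 ->
  (forall t, K t -> exists2 s, K s & t < s) ->
  (forall l, (fun s => dot (om s) l) @ at_end K --> dot w l) ->
  exists2 T, K T & segment (K `&` [set s | T <= s]) om ze.
Proof.
move=> kK K0 nomax omw; have FF := at_end_proper K0.
have iK := kin_interval kK.
have [a [wa amin]] := exists_minimal_stratum M w.
have [T0 KT0 near0] := (at_endP _ _).1 (near_stratum M FF omw).
have near_a t : K t -> T0 <= t -> (X a <= X (st (om t)))%VS.
  move=> Kt Tt; apply/amin/(near0 t Kt Tt)/stratum_mem; exact: kin_unit kK _ Kt.
pose tail T := K `&` [set s | T <= s].
have iT T : is_interval (tail T) by apply: is_intervalI => //; exact: is_interval_ge.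
have kT T : kinematic (tail T) om ze by apply: kin_sub kK => // s [].
pose z := oproj (X a) (ze T0).
have za : z \in X a by exact: oproj_mem.
have ze_z t l : K t -> T0 <= t -> l \in X a -> dot (ze t) l = dot z l.
  move=> Kt Tt la; rewrite /z oproj_dot //.
  apply: (@dwithin0_constant _ (tail T0) (fun s => dot (ze s) l)) => //.
  - move=> s [Ks Ts]; apply: (kin_ze (kT T0)) => //; exact: subvP (near_a s Ks Ts) _ la.
  - by split=> //=.
(* A later point exists as [K] has no last one; without it derivatives on the tail could be void. *)
have nondeg T t : tail T t -> exists2 u, tail T u & u != t.
  move=> [Kt Tt]; have [s Ks ts] := nomax t Kt; exists s; last by rewrite gt_eqF.
  by split=> //; exact: le_trans (ltW ts).
have K1T0 : tail T0 T0 by split=> //=.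
have nearT T : T0 <= T -> forall t, tail T t -> (X a <= X (st (om t)))%VS.
  by move=> TT t [Kt Tt]; apply: near_a => //; exact: le_trans Tt.
have zeT T : T0 <= T -> forall t l, tail T t -> l \in X a -> dot (ze t) l = dot z l.
  by move=> TT t l [Kt Tt]; apply: ze_z => //; exact: le_trans Tt.
have [xi [f [de rad]]] := near_radial ks_fibre (kT T0) (nearT T0 (lexx _)) za (zeT T0 (lexx _)).
have cvgw l : (fun s => dot (om s) l) @ at_end (tail T0) --> dot w l.
  apply: cvg_trans (omw l); apply: cvg_app => A /at_endP[U KU UA]; apply/at_endP.
  exists (Num.max U T0).
    by rewrite /Num.max; case: ifP => // UT; split=> //=; rewrite leNgt UT.
  by move=> s [Ks _]; rewrite ge_max => /andP[Us _]; exact: UA.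
have FT : ProperFilter (at_end (tail T0)) by apply: at_end_proper; exists T0.
have Ncvg : (fun s => dot (om s - oproj (X a) (om s)) (om s - oproj (X a) (om s)))
    @ at_end (tail T0) --> 0.
  rewrite -[X in _ --> X](@dot0l R n 0); apply: cvg_dot_self => l.
  have -> : dot 0 l = dot w (l - oproj (X a) l).
    by rewrite dot0l dotBr -oproj_adj oproj_id // subrr.
  by under eq_fun do rewrite dotBl oproj_adj -dotBr; exact: cvgw.
have [T [KT /= T0T] HT] := radial_dichotomy rad (ex_intro _ _ K1T0) Ncvg.
exists T => //; case: HT => [N0|pos].
  apply: (on_stratum_segment ks_fibre (kT T) (nearT T T0T) za (zeT T T0T) (nondeg T)).
  by move=> t [Kt Tt]; apply: N0 => //; split=> //; exact: le_trans Tt.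
apply: (radial_constant_segment ks_fibre (kT T) (nearT T T0T) za (zeT T T0T) (nondeg T) (t0 := T)).
- by split=> //=.
- by move=> t [Kt Tt]; have [] := pos t (conj Kt (le_trans T0T Tt)) Tt.
- by move=> t [Kt Tt]; have [] := pos t (conj Kt (le_trans T0T Tt)) Tt.
Qed.

(** The [om]-component of the Hamilton field is odd in [xi], and the spectral condition depends only
    on [|xi|^2]. *)
Lemma kin_reverse J om ze : kinematic J om ze ->
  kinematic (-%R @^-1` J) (fun s => om (- s)) (fun s => - ze (- s)).
Proof.
have preN t : - - t = t := opprK t.
move=> k; split.
- move=> x y Jx Jy s /andP[xs sy].
  by apply: (kin_interval k Jy Jx); rewrite !lerN2 xs sy.
- by move=> t /(kin_unit k).
- move=> t Jt; have [xi [[b [h1 h2 h3 h4]] d]] := kin_fibre k Jt.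
  exists (- xi); split.
    exists b; split=> //; [by rewrite rpredN|by rewrite dotNr dotNl opprK|].
    by rewrite -h4 /oproj linearN.
  have := dlowerNN d; rewrite preN; congr dlower.
    by apply/funext => s; rewrite dotNr.
  by rewrite !dotNr dotNl opprK sqrrN.
- move=> t l Jt lX; have := dwithinNN (kin_om k Jt lX).
  rewrite preN; congr dwithin; rewrite !dotNr !dotNl; ring.
- move=> t l Jt lX; have := dwithinNN (dwithinN (kin_ze k Jt lX)).
  by rewrite preN !oppr0; under eq_fun do rewrite -dotNl.
- move=> t l Jt; have /cvg_dwithinP H := @kin_cvg _ _ _ _ _ _ _ _ k _ l Jt.
  apply/cvg_dwithinP => e e0; have [d d0 dH] := H e e0; exists d => // s Js st_ sd.
  apply: dH => //; first by rewrite eqr_opp.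
  by rewrite -opprD normrN.
Qed.

Lemma segment_reverse S om ze : segment (-%R @^-1` S) (fun s => om (- s)) (fun s => - ze (- s)) ->
  segment S om ze.
Proof.
move=> [b [xi H]]; exists b, (- xi) => t St.
have [|h1 h2 h3 h4 h5] := H (- t) _; first by rewrite /= opprK.
rewrite opprK in h1 h4 h5.
split=> //; [by rewrite rpredN|by rewrite dotNr dotNl opprK| |].
  by rewrite /oproj linearN -[LHS]/(- oproj _ _) h4 opprK.
move=> l; have := dwithinNN (h5 l); rewrite opprK.
have -> : -%R @^-1` (-%R @^-1` S) = S.
  by apply/seteqP; split=> s; rewrite /= opprK.
under eq_fun do rewrite opprK; congr dwithin.
rewrite -dotNl; congr dot; rewrite -scalerN opprB dotNr scaleNr opprK addrC.
by [].
Qed.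

End EndSegment.

(** * One-sided segments, and finite chains on compact intervals *)

Section LocalSegments.
Context {R : realType} {n : nat} {I : finType} (M : manyBody R n I) (lambda : R).
Local Notation E := 'rV[R]_n.
Local Notation X := (mb_X M).
Local Notation st := (stratum M).
Local Notation kinematic := (kinematic M lambda).
Local Notation fibre := (fibre M lambda).
Local Notation segment := (segment M lambda).
Variable ks : seq R.
Hypothesis ks_fibre : forall w z xi : E, dot w w = 1 -> fibre w z xi -> dot xi xi \in ks.
Local Notation kcvg k l Jt := (@kin_cvg _ _ _ _ _ _ _ _ k _ l Jt).
Implicit Types (J K S : set R) (om ze : R -> E) (s t u v e T d : R) (w l xi : E) (a b : I).

Lemma dwithin_set1 (S : set R) (h : R -> R) t m : S `<=` [set t] -> dwithin S h t m.
Proof.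
move=> St; split; apply/cvg_dwithinP => e e0; exists 1 => // s /St ->.
by rewrite eqxx.
Qed.

(** A single point carries no derivative condition, so any [xi] in its fibre serves. *)
Lemma segment_set1 J S om ze t : kinematic J om ze -> J t -> S `<=` [set t] ->
  segment S om ze.
Proof.
move=> k Jt St; have [xi [[b [h1 h2 h3 h4]] _]] := kin_fibre k Jt.
by exists b, xi => s Ss; rewrite (St s Ss); split=> // l; exact: dwithin_set1.
Qed.

(** The segment obtained on [s < e] must be extended to [e]: [X b] is closed, the compressed
    momentum matches by constancy, and the velocity has a limit at [e]. *)
Lemma left_segment J om ze t e : kinematic J om ze -> J t -> J e -> t < e ->
  exists T, [/\ J T, T < e & segment (J `&` [set s | T <= s] `&` [set s | s <= e]) om ze].
Proof.
move=> k Jt Je te; have iJ := kin_interval k.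
pose K := J `&` [set s | s < e].
have iK : is_interval K by apply: is_intervalI => //; exact: is_interval_lt.
have kK : kinematic K om ze by apply: kin_sub k => // s [].
have K0 : K !=set0 by exists t; split.
have nomax s : K s -> exists2 u, K u & s < u.
  move=> [Js /= se]; exists ((s + e) / 2); last by lra.
  by split; [apply: (iJ s e) => //; apply/andP; split; lra|rewrite /=; lra].
have omw l : (fun s => dot (om s) l) @ at_end K --> dot (om e) l.
  by apply: (cvg_at_end iJ Jt te Je); exact: (kcvg k l Je).
have [T [JT /= Te] [b [xi H]]] := end_segment ks_fibre kK K0 nomax omw.
exists T; split=> //; exists b, xi.
pose S := J `&` [set s | T <= s] `&` [set s | s <= e].
have iJT : is_interval (J `&` [set s | T <= s]).
  by apply: is_intervalI => //; exact: is_interval_ge.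
have SK s : S s -> s != e -> (K `&` [set s | T <= s]) s.
  by move=> [[Js Ts] /= se] sne; split=> //; split=> //=; rewrite lt_neqAle sne.
have [_ xib sb _ _] := H T (conj (conj JT Te) (lexx T)).
have ome : om e \in X b.
  apply: memv_perpP => l /mem_perp lb.
  have FF := at_end_proper K0.
  have : (fun s => dot (om s) l) @ at_end K --> (0 : R).
    have c0 : (fun=> 0 : R) @ at_end K --> (0 : R) by exact: cvg_cst.
    apply: cvg_trans c0; apply: near_eq_cvg; apply/at_endP; exists T => // s Ks Ts.
    by have [sX _ _ _ _] := H s (conj Ks Ts); rewrite dotC lb.
  by move=> /(cvg_unique _ (omw l)) ->.
(* Strata just before [e] contain that of [e]. For [l] in the latter, [ze . l] is therefore constant
   up to and including [e], and equals [xi . l] at the earlier time [s]. *)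
have zeE : oproj (X (st (om e))) xi = ze e.
  have [d d0 dst] := kin_near_stratum k Je.
  have [xi' [[b' [_ _ _ ze_]] _]] := kin_fibre k Je.
  apply: oproj_uniq; first by rewrite -ze_ oproj_mem.
  move=> l le; pose s := Num.max T (e - d / 2).
  have se : s < e by rewrite gt_max Te /=; lra.
  have Ts : T <= s by rewrite le_max lexx.
  have ds : e - d / 2 <= s by rewrite le_max lexx orbT.
  pose K3 := J `&` [set x | s <= x] `&` [set x | x <= e].
  have iK3 : is_interval K3.
    apply: is_intervalI; last exact: is_interval_le.
    by apply: is_intervalI => //; exact: is_interval_ge.
  have Js : J s by apply: (iJ T e) => //; rewrite Ts ltW.
  have lst x : K3 x -> l \in X (st (om x)).
    move=> [[Jx /= sx] /= xe]; apply: subvP (dst x Jx _) _ le.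
    by rewrite ltr_norml; apply/andP; split; lra.
  have K3s : K3 s by split=> /=; [split=> //=|exact: ltW].
  have K3e : K3 e by split=> //=; split=> //=; exact: ltW.
  have [_ _ _ zs _] := H s (conj (conj Js se) Ts).
  rewrite -(oproj_dot xi (lst s K3s)) zs.
  apply: (@dwithin0_constant _ K3 (fun x => dot (ze x) l)) => // x K3x.
  have [[Jx _] _] := K3x.
  by apply: dwithin_sub (kin_ze k Jx (lst x K3x)) => y [[]].
move=> s Ss; have [se|se] := eqVneq s e; last first.
  have Ks := SK s Ss se; have [h1 h2 h3 h4 h5] := H s Ks; split=> // l.
  have [[Js Ts] /= se'] := Ss.
  have d0 : 0 < e - s by rewrite subr_gt0 lt_neqAle se.
  apply: (@dwithin_local _ _ _ (fun s => dot (om s) l) _ s _ _ d0) (h5 l) => // x Sx _ xs.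
  split=> //; apply: SK => //; apply: contraL xs => /eqP ->.
  by rewrite -leNgt ler_norm.
rewrite se; split=> // l.
pose F s := dot (2 *: (xi - dot (om s) xi *: om s)) l.
apply: (@dwithin_endpoint _ _ (fun s => dot (om s) l) F) => //.
- by split=> //=; exact: ltW.
- move=> x [Jx /= Tx] xe.
  have [_ _ _ _ h5] := H x (conj (conj Jx xe) Tx).
  have d0 : 0 < e - x by rewrite subr_gt0.
  apply: (@dwithin_local _ _ _ (fun s => dot (om s) l) _ x _ _ d0) (h5 l) => // y [Jy Ty] _ yx.
  split=> //; split=> //; split=> //=; move: yx; rewrite ltr_norml => /andP[_]; lra.
- apply: cvg_trans (kcvg k l Je); apply: cvg_app; apply: within_subset => y [] //.
- have omc l' : (fun s => dot (om s) l') @ within (J `&` [set s | T <= s]) e^' --> dot (om e) l'.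
    by apply: cvg_trans (kcvg k l' Je); apply: cvg_app; apply: within_subset => y [].
  have -> : F = fun s' => 2 * (dot xi l - dot (om s') xi * dot (om s') l).
    by apply/funext => s'; rewrite /F dotZl dotBl dotZl.
  have -> : dot (2 *: (xi - dot (om e) xi *: om e)) l =
      2 * (dot xi l - dot (om e) xi * dot (om e) l) by rewrite dotZl dotBl dotZl.
  apply: cvgM; first exact: cvg_cst.
  by apply: cvgB; [exact: cvg_cst|exact: cvgM].
Qed.

Lemma left_segment_radius J om ze e : kinematic J om ze -> J e ->
  exists2 d, 0 < d & segment (J `&` [set s | e - d <= s] `&` [set s | s <= e]) om ze.
Proof.
move=> k Je; have [[t [Jt te]]|H] := pselect (exists t, J t /\ t < e).
  have [T [JT Te sT]] := left_segment k Jt Je te.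
  by exists (e - T); [rewrite subr_gt0|rewrite subKr].
(* With no point of [J] before [e] the set is the single point [e], so any radius will do. *)
exists 1 => //; apply: (segment_set1 k Je) => s [[Js _] /= se].
by apply/eqP; rewrite eq_le se /= leNgt; apply/negP => ?; apply: H; exists s.
Qed.

Lemma right_segment_radius J om ze e : kinematic J om ze -> J e ->
  exists2 d, 0 < d & segment (J `&` [set s | e <= s] `&` [set s | s <= e + d]) om ze.
Proof.
move=> k Je; have [|d d0 H] := left_segment_radius (e := - e) (kin_reverse k).
  by rewrite /= opprK.
exists d => //; apply: segment_reverse; apply: segment_sub H => s [[Js /= es] /= sd].
by split=> /=; [split=> //=|]; lra.
Qed.

Definition chain om ze u v := exists (k : nat) (t : nat -> R),
  [/\ t 0%N = u, t k = v & forall j, (j < k)%N ->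
     t j < t j.+1 /\ segment `[t j, t j.+1] om ze].

Lemma chain_refl om ze u : chain om ze u u.
Proof. by exists 0%N, (fun=> u). Qed.

Lemma chain_trans1 om ze u v v' : chain om ze u v -> v < v' -> segment `[v, v'] om ze ->
  chain om ze u v'.
Proof.
move=> [k [t [t0 tk H]]] vw sg.
exists k.+1, (fun j => if (j <= k)%N then t j else v'); split=> //.
  by rewrite ltnn.
move=> j; rewrite ltnS leq_eqVlt => /predU1P[->|jk].
  by rewrite eqxx ltnn tk.
by rewrite jk orbT; exact: H.
Qed.

(** Real induction plays the part of compactness: a right segment prolongs a chain, and a left
    segment at a limit time is reached from any chain that ends close enough below it. *)
Lemma kin_chain J om ze u v : kinematic J om ze -> J u -> J v -> u <= v ->
  chain om ze u v.
Proof.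
move=> k Ju Jv uv; have iJ := kin_interval k.
have Ks s : u <= s -> s <= v -> J s by move=> us sv; apply: (iJ u v) => //; rewrite us.
apply: (@real_induction _ (chain om ze u) u v uv (chain_refl om ze u)).
  move=> s us sv ch; have [d d0 sg] := right_segment_radius k (Ks s us (ltW sv)).
  exists (Num.min v (s + d)).
  have s1 : s < Num.min v (s + d) by rewrite lt_min sv /=; lra.
  have s2 : Num.min v (s + d) <= s + d by rewrite ge_min lexx orbT.
  have s3 : Num.min v (s + d) <= v by rewrite ge_min lexx.
  move: (Num.min _ _) s1 s2 s3 => s' s1 s2 s3; split=> //.
  apply: chain_trans1 ch s1 _; apply: segment_sub sg => x /=.
  rewrite in_itv /= => /andP[sx xs']; split; last by rewrite /=; lra.
  by split=> //; apply: Ks; lra.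
move=> s us sv lim; have [d d0 sg] := left_segment_radius k (Ks s (ltW us) sv).
have [||x [dx xs ch]] := lim (Num.max u (s - d)).
- by rewrite le_max lexx.
- by rewrite gt_max us /=; lra.
move: dx; rewrite ge_max => /andP[ux dx].
apply: chain_trans1 ch xs _; apply: segment_sub sg => y /=.
rewrite in_itv /= => /andP[xy ys]; split=> //; split; last by rewrite /=; lra.
by apply: Ks; lra.
Qed.

End LocalSegments.

(** * Monotonicity across pieces, and the speed estimate *)

Section Global.
Context {R : realType} {n : nat} {I : finType} (M : manyBody R n I) (lambda : R).
Local Notation E := 'rV[R]_n.
Local Notation X := (mb_X M).
Local Notation st := (stratum M).
Local Notation kinematic := (kinematic M lambda).
Local Notation fibre := (fibre M lambda).
Local Notation segment := (segment M lambda).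
Variable ks : seq R.
Hypothesis ks_fibre : forall w z xi : E, dot w w = 1 -> fibre w z xi -> dot xi xi \in ks.
Implicit Types (J K S : set R) (om ze : R -> E) (s t u v e T d : R) (w l xi : E) (a b : I).

(** Every point of [J] has a segment on each side, so signs of derivatives need checking inside one
    segment only. No count of pieces is involved, as they might still accumulate at an end of
    [J]. *)
Lemma segments_nondecreasing J om ze (Phi : R -> R) : kinematic J om ze ->
  (forall t S, J t -> S t -> S `<=` J -> is_interval S -> segment S om ze -> dlower S Phi t 0) ->
  forall s t, J s -> J t -> s <= t -> Phi s <= Phi t.
Proof.
move=> k H; apply: dlower_nondecreasing; first exact: kin_interval k.
move=> t Jt; have iJ := kin_interval k; apply: dlower_glue.
  have [d d0 sg] := left_segment_radius ks_fibre k Jt.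
  have : dlower (J `&` [set s | t - d <= s] `&` [set s | s <= t]) Phi t 0.
    apply: H => //; [by split=> //=; split=> //=; lra|by move=> x [[]]|].
    apply: is_intervalI; last exact: is_interval_le.
    by apply: is_intervalI => //; exact: is_interval_ge.
  apply: (@dlower_local _ _ _ _ _ _ _ d) => // s [Js /= st_] _.
  by rewrite ltr_norml => /andP[ds _]; split=> //; split=> //; split=> //=; lra.
have [d d0 sg] := right_segment_radius ks_fibre k Jt.
have : dlower (J `&` [set s | t <= s] `&` [set s | s <= t + d]) Phi t 0.
  apply: H => //; [by split=> /=; [split=> /=|lra]|by move=> x [[]]|].
  apply: is_intervalI; last exact: is_interval_le.
  by apply: is_intervalI => //; exact: is_interval_ge.
apply: (@dlower_local _ _ _ _ _ _ _ d) => // s [Js /= st_] _.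
by rewrite ltr_norml => /andP[_ ds]; split=> //; split=> //=; lra.
Qed.

(** [kap] is [|xi|^2] for the momentum of the segment, [xi - eta om] is half the velocity and has
    square norm [kap - eta^2]; [m] is its component along [l], bounded by Cauchy-Schwarz. *)
Lemma segment_speed J S om ze t : kinematic J om ze -> S `<=` J -> S t ->
  segment S om ze -> exists kap, let eta s := dot (om s) (ze s) in
  [/\ kap \in ks, eta t ^+ 2 <= kap, dwithin S eta t (2 * (kap - eta t ^+ 2)) &
      forall l, exists m, dwithin S (fun s => dot (om s) l) t (2 * m) /\
        m ^+ 2 <= (kap - eta t ^+ 2) * dot l l].
Proof.
move=> k SJ St [b [xi H]]; exists (dot xi xi) => /=.
have f s : S s -> fibre (om s) (ze s) xi.
  by move=> Ss; have [h1 h2 h3 h4 h5] := H s Ss; exists b.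
have etaE s : S s -> dot (om s) xi = dot (om s) (ze s).
  by move=> Ss; exact: (fibre_eta (kin_unit k (SJ _ Ss)) (f s Ss)).
have u1 := kin_unit k (SJ _ St).
have qE : dot (xi - dot (om t) xi *: om t) (xi - dot (om t) xi *: om t) =
    dot xi xi - dot (om t) (ze t) ^+ 2.
  rewrite -etaE // dotBl !dotBr !dotZl !dotZr u1 (dotC xi (om t)).
  by ring.
have [_ _ _ _ d] := H t St.
split.
- exact: ks_fibre u1 (f t St).
- by rewrite -subr_ge0 -qE dot_ge0.
- have := d xi; rewrite dotZl dotBl dotZl -expr2 etaE //.
  by apply: (@dwithin_local _ _ _ _ _ _ _ 1) => // [s Ss _ _|]; [split=> //|]; exact: etaE.
- move=> l; exists (dot (xi - dot (om t) xi *: om t) l).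
  by split; [rewrite -dotZl; exact: d|rewrite -qE; exact: dot_CS].
Qed.

Lemma finite_gap_below (A : seq R) x : exists2 e, 0 < e & forall y, y \in A -> y < x -> y <= x - e.
Proof.
have [e e0 H] := finite_gap [seq - y | y <- A] (- x); exists e => // y yA yx.
by have := H (- y) (map_f _ yA); rewrite ltrN2 => /(_ yx); lra.
Qed.

(* A Lojasiewicz-type inequality for the energy [eta], due to the finiteness
   of the set of values of [|xi|^2]. *)
Lemma speed_lower_bound J (eta : R -> R) etae : J !=set0 ->
  (forall s t, J s -> J t -> s <= t -> eta s <= eta t) ->
  eta @ at_end J --> etae -> (forall t, J t -> eta t < etae) ->
  exists T c, [/\ J T, 0 < c & forall t kap, J t -> T <= t -> kap \in ks ->
    eta t ^+ 2 <= kap -> c * (etae - eta t) <= kap - eta t ^+ 2].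
Proof.
move=> J0 mono ec lt_e; have FF := at_end_proper J0.
have e2c : (fun t => eta t * eta t) @ at_end J --> etae * etae by exact: cvgM.
have [e0|e0] := ltP 0 etae.
  (* Here [kap >= eta^2 > etae^2 - e] late enough, so the gap gives [kap >= etae^2]. Then
     [kap - eta^2 >= (etae - eta) (etae + eta)], and [c = etae] works since [eta > 0]. *)
  have [e e1 gap] := finite_gap_below ks (etae ^+ 2).
  have [T1 JT1 H1] : exists2 T, J T & forall s, J s -> T <= s ->
      - (eta s * eta s) < - (etae ^+ 2) + e.
    by apply: (at_end_lt J0 (cvgN e2c)); rewrite -expr2 ltrDl.
  have [T2 JT2 H2] : exists2 T, J T & forall s, J s -> T <= s -> - eta s < 0.
    by apply: (at_end_lt J0 (cvgN ec)); rewrite oppr_lt0.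
  exists (Num.max T1 T2), etae; split=> //; first by rewrite /Num.max; case: ifP.
  move=> t kap Jt; rewrite ge_max => /andP[/(H1 _ Jt) h1 /(H2 _ Jt) h2] kin_ kge.
  have h3 := lt_e t Jt.
  have : etae ^+ 2 <= kap.
    rewrite leNgt; apply/negP => klt; have := gap _ kin_ klt.
    by rewrite -expr2 in h1; lra.
  rewrite expr2 expr2; rewrite oppr_lt0 in h2; move: (eta t) h2 h3 => x x0 xe.
  have : 0 <= (etae - x) * x by rewrite mulr_ge0 //; lra.
  by lra.
(* Now [eta < etae <= 0], so [kap >= eta^2 > etae^2] jumps to [etae^2 + e] and
   [kap - eta^2 >= e / 2]. The constant divides this by the largest value of [etae - eta] after
   [T1]. *)
have [e e1 gap] := finite_gap ks (etae ^+ 2).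
have [T0 JT0] := J0.
have [T1 JT1 H1] : exists2 T, J T & forall s, J s -> T <= s -> eta s * eta s < etae ^+ 2 + e / 2.
  by apply: (at_end_lt J0 e2c); rewrite -expr2 ltrDl divr_gt0.
have U0 : 0 < etae - eta T1 by rewrite subr_gt0 lt_e.
exists T1, (e / 2 / (etae - eta T1)); split=> //; first by rewrite !divr_gt0.
move=> t kap Jt T1t kin_ kge.
have h1 := H1 t Jt T1t; have h3 := lt_e t Jt.
have h4 := mono _ _ JT1 Jt T1t.
have : etae ^+ 2 + e <= kap.
  apply: gap => //; apply: lt_le_trans kge.
  by rewrite !expr2; move: (eta t) h3 => x xe; nra.
rewrite -expr2 in h1 => h5.
apply: (@le_trans _ _ (e / 2)); last by lra.
by rewrite mulrAC ler_pdivrMr // ler_pM2l ?divr_gt0 //; lra.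
Qed.

End Global.

(** * Convergence at the ends of the interval, and the finite decomposition *)

Section Piecewise.
Context {R : realType} {n : nat} {I : finType} (M : manyBody R n I) (lambda : R).
Local Notation E := 'rV[R]_n.
Local Notation X := (mb_X M).
Local Notation st := (stratum M).
Local Notation kinematic := (kinematic M lambda).
Local Notation fibre := (fibre M lambda).
Local Notation segment := (segment M lambda).
Variable ks : seq R.
Hypothesis ks_fibre : forall w z xi : E, dot w w = 1 -> fibre w z xi -> dot xi xi \in ks.
Implicit Types (J K S : set R) (om ze : R -> E) (s t u v e T d : R) (w l xi : E) (a b : I).

Lemma is_cvg_dot (F : set_system R) (FF : Filter F) (u : R -> E) :
  (forall l, exists c : R, (fun s => dot (u s) l) @ F --> c) ->
  exists w, forall l, (fun s => dot (u s) l) @ F --> dot w l.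
Proof.
move=> H; have /choice[c Hc] : forall i : 'I_n, exists c : R, (fun s => u s 0 i) @ F --> c.
  move=> i; have [c Hc] := H (delta_mx 0 i); exists c.
  by under eq_fun do rewrite -dot_delta.
exists (\row_i c i) => l; rewrite /dot; elim: (index_enum _) => [|i r IH].
  by rewrite big_nil; under eq_fun do rewrite big_nil; exact: cvg_cst.
rewrite big_cons; under eq_fun do rewrite big_cons.
by apply: cvgD => //; rewrite mxE; apply: cvgM; [exact: Hc|exact: cvg_cst].
Qed.

Lemma om_dot_bound J om ze t l : kinematic J om ze -> J t -> - dot (om t) l <= 1 + dot l l.
Proof.
move=> k Jt; have := dot_CS (om t) l; rewrite (kin_unit k Jt) mul1r.
have := dot_ge0 l; move: (dot l l) (dot (om t) l) => y x; nra.
Qed.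

(** Unless [eta] attains its supremum, each [om . l] is a combination of [v], which tends to 0, and
    the bounded monotone function [Phi]. *)
Lemma om_is_cvg_at_end J om ze : kinematic J om ze -> J !=set0 ->
  exists w, forall l, (fun s => dot (om s) l) @ at_end J --> dot w l.
Proof.
move=> k J0; have FF := at_end_proper J0; have iJ := kin_interval k.
pose eta s := dot (om s) (ze s).
have mono s t : J s -> J t -> s <= t -> eta s <= eta t.
  apply: dlower_nondecreasing => // x Jx; have [xi [f d]] := kin_fibre k Jx.
  apply: dlowerW d; rewrite mulr_ge0 // subr_ge0 -(fibre_eta (kin_unit k Jx) f).
  by have := dot_CS (om x) xi; rewrite (kin_unit k Jx) mul1r.
have etaM t : J t -> eta t <= momentum_bound ks.
  by move=> Jt; apply: le_trans (ler_norm _) _; exact (eta_bound ks_fibre k Jt).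
have ec := nondecreasing_cvg_at_end J0 mono etaM.
set etae := sup _ in ec.
have supJ : has_sup (eta @` J).
  have [t0 Jt0] := J0.
  by split; [exists (eta t0), t0|exists (momentum_bound ks) => _ [t Jt <-]; exact: etaM].
have le_e t : J t -> eta t <= etae.
  by move=> Jt; apply: sup_upper_bound => //; exists t.
have tail T : kinematic (J `&` [set s | T <= s]) om ze.
  apply: kin_sub k; last by move=> s [].
  by apply: is_intervalI => //; exact: is_interval_ge.
apply: is_cvg_dot => l.
(* Once [eta] attains its supremum it is constant, hence [kap = eta^2] on every segment: the
   velocity vanishes and [om] is at rest. *)
have [[T [JT eT]]|lt_e] := pselect (exists T, J T /\ eta T = etae).
  exists (dot (om T) l).
  have c0 : (fun=> dot (om T) l) @ at_end J --> dot (om T) l by exact: cvg_cst.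
  apply: cvg_trans c0; apply: near_eq_cvg; apply/at_endP; exists T => // t Jt Tt.
  pose J' := J `&` [set s | T <= s].
  have etaJ' s : J' s -> eta s = etae.
    move=> [Js Ts]; apply/eqP; rewrite eq_le le_e //= -eT; exact: mono.
  have d0 x S : J' x -> S x -> S `<=` J' -> is_interval S -> segment S om ze ->
      dwithin S (fun s => dot (om s) l) x 0.
    move=> J'x Sx SJ' iS sg.
    have [[y Sy yx]|H] := pselect (exists2 y, S y & y != x); last first.
      apply: dwithin_set1 => y Sy; apply: contrapT => /eqP yx.
      by apply: H; exists y.
    have [kap /= [_ kge de dl]] := segment_speed ks_fibre (tail T) SJ' Sx sg.
    have q0 : kap - eta x ^+ 2 = 0.
      apply/eqP; rewrite eq_le subr_ge0 kge andbT.
      have e0 : dwithin S eta x 0.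
        apply: (@dwithin_local _ S _ (fun=> etae) _ _ _ 1) (dwithin_cst S etae x) => //.
          by move=> s Ss _ _; split=> //; rewrite etaJ' //; exact: SJ'.
        by rewrite etaJ' //; exact: SJ'.
      have := dlower_le_dwithin iS Sx Sy yx (dwithin_dlower de (lexx _)) e0.
      by rewrite pmulr_rle0.
    have [m [dm]] := dl l; rewrite -/(eta x) q0 mul0r => m2.
    have m0 : m = 0.
      by apply/eqP; rewrite -sqrf_eq0 eq_le m2 sqr_ge0.
    by move: dm; rewrite m0 mulr0.
  have J'T : J' T by split=> //=.
  have J't : J' t by split.
  apply/eqP; rewrite eq_le; apply/andP; split; last rewrite -lerN2.
    apply: (segments_nondecreasing ks_fibre (tail T) (Phi := fun s => dot (om s) l)) => //.
    by move=> x S J'x Sx SJ' iS sg; apply: dwithin_dlower (d0 x S J'x Sx SJ' iS sg) _.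
  apply: (segments_nondecreasing ks_fibre (tail T) (Phi := fun s => - dot (om s) l)) => //.
  move=> x S J'x Sx SJ' iS sg.
  by apply: dwithin_dlower (dwithinN (d0 x S J'x Sx SJ' iS sg)) _; rewrite oppr0.
have {}lt_e t : J t -> eta t < etae.
  move=> Jt; rewrite lt_neqAle le_e // andbT; apply/eqP => tE.
  by apply: lt_e; exists t.
have [T [c [JT c0 Hc]]] := speed_lower_bound ks J0 mono ec lt_e.
pose L := dot l l; have L0 : 0 <= L by exact: dot_ge0.
(* [Phi' = C q / v - 2 m] with [q = kap - eta^2]. From [m^2 <= q L] and [c v^2 <= q],
   [4 m^2 v^2 <= 4 L q v^2 <= (4 L / c) q^2]; so [C^2 c = 4 L] is what makes [Phi' >= 0]. *)
pose C := 2 * Num.sqrt (L / c).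
have C0 : 0 <= C by rewrite mulr_ge0 // sqrtr_ge0.
have C2 : C ^+ 2 * c = 4 * L.
  rewrite exprMn sqr_sqrtr ?divr_ge0 ?(ltW c0) // -mulrA divfK ?gt_eqF //.
  by rewrite -natrX.
pose J' := J `&` [set s | T <= s].
pose v s := Num.sqrt (etae - eta s).
pose Phi s := - (C * v s) - dot (om s) l.
have J'T : J' T by split=> //=.
have monoPhi s t : J' s -> J' t -> s <= t -> Phi s <= Phi t.
  apply: (segments_nondecreasing ks_fibre (tail T)) => x S [Jx /= Tx] Sx SJ' iS sg.
  have [kap /= [kin_ kge de dl]] := segment_speed ks_fibre (tail T) SJ' Sx sg.
  have [m [dm m2]] := dl l.
  have u0 : 0 < etae - eta x by rewrite subr_gt0 lt_e.
  have v0 : 0 < v x by rewrite sqrtr_gt0.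
  have v2 : v x ^+ 2 = etae - eta x by rewrite sqr_sqrtr // ltW.
  have := dwithin_comp (dwithinB (dwithin_cst S etae x) de) (is_derive1_sqrt u0).
  move=> /(@dwithinZ _ _ C)/dwithinN/dwithinB/(_ dm)/dwithin_dlower; apply.
  have := Hc x kap Jx Tx kin_ kge; rewrite -/(v x) -/(eta x) in m2 *.
  rewrite -v2; move: m2; move: (kap - _) => q m2 q1.
  rewrite -/L in m2.
  have q0 : 0 <= q by apply: le_trans q1; rewrite mulr_ge0 ?sqr_ge0 // ltW.
  suff : 2 * m * v x <= C * q.
    move=> H; rewrite [leRHS](_ : _ = (C * q - 2 * m * v x) / v x); last first.
      by field; rewrite gt_eqF.
    by rewrite divr_ge0 ?(ltW v0) // subr_ge0.
  have Cq : 0 <= C * q by rewrite mulr_ge0.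
  have sq : (2 * m * v x) ^+ 2 <= (C * q) ^+ 2.
    have h1 : 4 * m ^+ 2 * v x ^+ 2 <= 4 * (q * L) * v x ^+ 2.
      by rewrite ler_wpM2r ?sqr_ge0 // ler_pM2l.
    have h2 : C ^+ 2 * q * (c * v x ^+ 2) <= C ^+ 2 * q * q.
      by rewrite ler_wpM2l // mulr_ge0 // sqr_ge0.
    have -> : (2 * m * v x) ^+ 2 = 4 * m ^+ 2 * v x ^+ 2 by ring.
    have -> : (C * q) ^+ 2 = C ^+ 2 * q * q by ring.
    apply: le_trans h1 _; apply: le_trans h2.
    rewrite (_ : C ^+ 2 * q * _ = C ^+ 2 * c * q * v x ^+ 2); last by ring.
    by rewrite C2 le_eqVlt; apply/orP; left; apply/eqP; ring.
  rewrite leNgt; apply/negP => lt; have := sq; rewrite leNgt => /negP; apply.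
  by rewrite ltr_pXn2r ?nnegrE //; exact: le_trans (ltW lt).
have PhiM t : J' t -> Phi t <= 1 + L.
  move=> [Jt _]; have := om_dot_bound l k Jt; rewrite /Phi -/L.
  have : 0 <= C * v t by rewrite mulr_ge0 // sqrtr_ge0.
  by lra.
have Phic := nondecreasing_cvg_at_end (ex_intro _ _ J'T) monoPhi PhiM.
have {}Phic : Phi @ at_end J --> sup (Phi @` J').
  apply: cvg_trans Phic; apply: cvg_app => A /at_endP[U [JU TU] UA].
  apply/at_endP; exists U => // s Js Us; apply: UA => //; split=> //.
  exact: le_trans Us.
have vc : v @ at_end J --> 0.
  have := cvg_comp _ _ (cvgB (cvg_cst etae) ec) (@sqrt_continuous R (etae - etae)).
  by rewrite subrr sqrtr0; exact.
exists (- (C * 0) - sup (Phi @` J')).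
rewrite (_ : (fun s => dot (om s) l) = fun s => - (C * v s) - Phi s).
  by apply: cvgB => //; apply: cvgN; apply: cvgM => //; exact: cvg_cst.
by apply/funext => s; rewrite /Phi; ring.
Qed.

Lemma tail_segment J om ze : kinematic J om ze -> J !=set0 ->
  exists2 T, J T & segment (J `&` [set s | T <= s]) om ze.
Proof.
move=> k J0; have [[e [Je eM]]|H] := pselect (exists e, J e /\ forall s, J s -> s <= e).
  exists e => //; apply: (segment_set1 k Je) => s [Js /= es].
  by apply/eqP; rewrite eq_le eM.
have [w omw] := om_is_cvg_at_end k J0.
apply: (end_segment ks_fibre k J0 _ omw) => t Jt.
apply: contrapT => H'; apply: H; exists t; split=> // s Js.
by rewrite leNgt; apply/negP => ts; apply: H'; exists s.
Qed.

Lemma chain_bounds om ze u v k (t : nat -> R) : t 0%N = u -> t k = v ->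
  (forall j, (j < k)%N -> t j < t j.+1 /\ segment `[t j, t j.+1] om ze) ->
  forall j, (j <= k)%N -> u <= t j <= v.
Proof.
move=> t0 tk H j jk; apply/andP; split.
  elim: j jk => [|j IH] jk; first by rewrite t0.
  by apply: le_trans (IH (ltnW jk)) _; apply/ltW; have [] := H j jk.
have H' i : (i <= k)%N -> t (k - i)%N <= v.
  elim: i => [|i IH] ik; first by rewrite subn0 tk.
  apply: le_trans (IH (ltnW ik)); apply: ltW.
  have ki : (k - i.+1 < k)%N by rewrite ltn_subrL /= (leq_ltn_trans _ ik).
  by have [] := H _ ki; rewrite -subSn // subSS.
by rewrite -(subKn jk); apply: H'; exact: leq_subr.
Qed.

Lemma kin_piecewise J om ze : kinematic J om ze -> J !=set0 ->
  exists (k : nat) (t : nat -> R),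
    [/\ forall j, (j <= k)%N -> J (t j),
        forall j, (j < k)%N -> t j < t j.+1 &
    [/\ segment (J `&` [set s | s <= t 0%N]) om ze,
        forall j, (j < k)%N -> segment `[t j, t j.+1] om ze &
        segment (J `&` [set s | t k <= s]) om ze]].
Proof.
move=> k J0; have iJ := kin_interval k.
have [v0 Jv0 sv] := tail_segment k J0.
have [|u' Ju' su] := tail_segment (kin_reverse k).
  by have [t Jt] := J0; exists (- t); rewrite /= opprK.
pose u := - u'; have {}su : segment (J `&` [set s | s <= u]) om ze.
  apply: segment_reverse; apply: segment_sub su => s [Js /= us]; split=> //=.
  by rewrite -lerN2.
(* The initial and final segments may overlap; shortening the final one ensures [u <= v], as a chain
   requires. *)
pose v := Num.max u v0.
have Ju : J u by [].
have Jv : J v by rewrite /v /Num.max; case: ifP.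
have uv : u <= v by rewrite le_max lexx.
have {}sv : segment (J `&` [set s | v <= s]) om ze.
  apply: segment_sub sv => s [Js /=]; rewrite ge_max => /andP[_ ?].
  by split.
have [m [t [t0 tm H]]] := kin_chain ks_fibre k Ju Jv uv.
exists m, t; split.
- by move=> j jm; apply: (iJ u v) => //; exact: chain_bounds t0 tm H j jm.
- by move=> j jm; have [] := H j jm.
- by rewrite t0 tm; split=> // j jm; have [] := H j jm.
Qed.

End Piecewise.

(** * Polynomial test functions *)

Section Polynomials.
Context {R : realType} {W : normedModType R}.
Implicit Types (f g : W -> R) (df dg : W -> W -> R) (v p : W) (c : R).

(** A function together with its directional derivatives [df v p]. Since each [df v] is again of
    this kind, smoothness follows by induction, and Hamilton derivatives are read off the second
    component. *)
Inductive polynomial_deriv : (W -> R) -> (W -> W -> R) -> Prop :=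
| Poly_cst c : polynomial_deriv (fun=> c) (fun _ _ => 0)
| Poly_lin (l : {linear W -> R^o}) :
    continuous l -> polynomial_deriv l (fun v _ => l v)
| Poly_add f df g dg : polynomial_deriv f df -> polynomial_deriv g dg ->
    polynomial_deriv (fun p => f p + g p) (fun v p => df v p + dg v p)
| Poly_mul f df g dg : polynomial_deriv f df -> polynomial_deriv g dg ->
    polynomial_deriv (fun p => f p * g p) (fun v p => f p * dg v p + g p * df v p).

Lemma poly_differentiable f df p : polynomial_deriv f df -> differentiable f p.
Proof.
elim=> [c|l lc|{}f {}df g dg _ IHf _ IHg|{}f {}df g dg _ IHf _ IHg].
- exact: differentiable_cst.
- exact: linear_differentiable.
- exact: differentiableD.
- exact: differentiableM.
Qed.

Lemma poly_derive f df p v : polynomial_deriv f df -> 'D_v f p = df v p.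
Proof.
elim=> [c|l lc|{}f {}df g dg Hf IHf Hg IHg|{}f {}df g dg Hf IHf Hg IHg].
- exact: derive_cst.
- by rewrite deriveE ?diff_lin //; exact: linear_differentiable.
- rewrite (deriveD (f := f) (g := g)) ?IHf ?IHg //.
    exact/diff_derivable/(poly_differentiable p Hf).
  exact/diff_derivable/(poly_differentiable p Hg).
- rewrite (deriveM (f := f) (g := g)) ?IHf ?IHg //.
    exact/diff_derivable/(poly_differentiable p Hf).
  exact/diff_derivable/(poly_differentiable p Hg).
Qed.

Lemma poly_deriv_poly f df v : polynomial_deriv f df -> exists ddf, polynomial_deriv (df v) ddf.
Proof.
elim=> [c|l lc|{}f {}df g dg Hf [ddf Hdf] Hg [ddg Hdg]|{}f {}df g dg Hf [ddf Hdf] Hg [ddg Hdg]].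
- by eexists; exact: Poly_cst.
- by eexists; exact: Poly_cst.
- by eexists; exact: Poly_add Hdf Hdg.
- by eexists; exact: Poly_add (Poly_mul Hf Hdg) (Poly_mul Hg Hdf).
Qed.

Lemma poly_smooth f df : polynomial_deriv f df -> smooth_on setT f.
Proof.
move=> Hf vs p _.
suff [dg Hg] : exists dg, polynomial_deriv (Defs.iterD vs f) dg by exact: poly_differentiable Hg.
elim: vs => [|v vs [dg Hg]] /=; first by exists df.
have -> : 'D_v (Defs.iterD vs f) = dg v by apply/funext => x; exact: poly_derive.
exact: poly_deriv_poly Hg.
Qed.

Lemma poly_ext f g df dg : (forall p, f p = g p) -> (forall v p, df v p = dg v p) ->
  polynomial_deriv f df -> polynomial_deriv g dg.
Proof.
move=> fg dfg; have <- : f = g by apply/funext.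
by have <- : df = dg by apply/funext => v; apply/funext.
Qed.

Lemma poly_sum (T : Type) (r : seq T) (f : T -> W -> R) (df : T -> W -> W -> R) :
  (forall i, polynomial_deriv (f i) (df i)) ->
  polynomial_deriv (fun p => \sum_(i <- r) f i p) (fun v p => \sum_(i <- r) df i v p).
Proof.
move=> H; elim: r => [|i r IH].
  by apply: poly_ext (Poly_cst 0) => *; rewrite big_nil.
by apply: poly_ext (Poly_add (H i) IH) => *; rewrite big_cons.
Qed.

Lemma poly_prod (T : Type) (r : seq T) (P : pred T) (f : T -> W -> R) :
  (forall i, exists df, polynomial_deriv (f i) df) ->
  exists df, polynomial_deriv (fun p => \prod_(i <- r | P i) f i p) df.
Proof.
move=> H; elim: r => [|i r [df IH]].
  by exists (fun _ _ => 0); apply: poly_ext (Poly_cst 1) => // p; rewrite big_nil.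
have [Pi|Pi] := boolP (P i); last first.
  by exists df; apply: poly_ext IH => // p; rewrite big_cons (negbTE Pi).
have [dfi Hi] := H i; eexists; apply: poly_ext (Poly_mul Hi IH) => [p|v p]; last by [].
by rewrite big_cons Pi.
Qed.

End Polynomials.

Section PhaseSpacePolynomials.
Context {R : realType} {n : nat}.
Local Notation E := 'rV[R]_n.
Implicit Types (l : E) (p v : E * E).

Definition dot_fst l p : R^o := dot p.1 l.
Definition dot_snd l p : R^o := dot p.2 l.

Fact dot_fst_linear l : linear (dot_fst l).
Proof. by move=> a p q; rewrite /dot_fst /= dotDl dotZl. Qed.
HB.instance Definition _ l :=
  GRing.isLinear.Build R (E * E)%type R^o _ (dot_fst l) (dot_fst_linear l).

Fact dot_snd_linear l : linear (dot_snd l).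
Proof. by move=> a p q; rewrite /dot_snd /= dotDl dotZl. Qed.
HB.instance Definition _ l :=
  GRing.isLinear.Build R (E * E)%type R^o _ (dot_snd l) (dot_snd_linear l).

Lemma cvg_coord_dot (F : set_system (E * E)) (FF : Filter F) (u : E * E -> E) w l :
  u @ F --> w -> (fun p => dot (u p) l) @ F --> dot w l.
Proof.
move=> uw; rewrite /dot; elim: (index_enum _) => [|i r IH].
  by rewrite big_nil; under eq_fun do rewrite big_nil; exact: cvg_cst.
rewrite big_cons; under eq_fun do rewrite big_cons.
apply: cvgD => //; apply: cvgM; last exact: cvg_cst.
exact: (cvg_comp _ _ uw (@coord_continuous _ _ _ 0 i w)).
Qed.

Lemma dot_fst_continuous l : continuous (dot_fst l).
Proof. by move=> p; apply: cvg_coord_dot; exact: cvg_fst. Qed.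

Lemma dot_snd_continuous l : continuous (dot_snd l).
Proof. by move=> p; apply: cvg_coord_dot; exact: cvg_snd. Qed.

Lemma poly_dot_fst l :
  polynomial_deriv (fun p : E * E => dot p.1 l) (fun v _ => dot v.1 l).
Proof. exact: (Poly_lin (@dot_fst_continuous l)). Qed.

Lemma poly_dot_snd l :
  polynomial_deriv (fun p : E * E => dot p.2 l) (fun v _ => dot v.2 l).
Proof. exact: (Poly_lin (@dot_snd_continuous l)). Qed.

Lemma poly_dot :
  polynomial_deriv (fun p : E * E => dot p.1 p.2)
    (fun v p => dot p.1 v.2 + dot p.2 v.1).
Proof.
apply: poly_ext (poly_sum (index_enum 'I_n) (fun i =>
    Poly_mul (poly_dot_fst (delta_mx 0 i)) (poly_dot_snd (delta_mx 0 i)))) => [p|v p].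
  by apply: eq_bigr => i _; rewrite !dot_delta.
rewrite big_split /=.
by congr (_ + _); apply: eq_bigr => i _; rewrite !dot_delta.
Qed.

(* [|x - oproj U x|^2], which vanishes exactly on [U]. *)
Lemma poly_dist_fst (U : {vspace E}) : exists df, polynomial_deriv
  (fun p : E * E => dot (p.1 - oproj U p.1) (p.1 - oproj U p.1)) df.
Proof.
pose l i : E := delta_mx 0 i - oproj U (delta_mx 0 i).
eexists; apply: poly_ext (poly_sum (index_enum 'I_n) (fun i =>
    Poly_mul (poly_dot_fst (l i)) (poly_dot_fst (l i)))) => [p|v p]; last by [].
by apply: eq_bigr => i _; rewrite dotBr -oproj_adj -dotBl dot_delta.
Qed.

End PhaseSpacePolynomials.

(** * Broken bicharacteristics *)

Section DiniBounds.
Context {R : realType}.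
Implicit Types (J : set R) (h : R -> R) (t m : R) (right : bool).

Lemma dini_geP right J h t m :
  (m%:E <= dini right J h t)%E <->
  forall e, 0 < e ->
    \forall s \near within J (if right then t^'+ else t^'-), m - e <= slope h t s.
Proof.
set F : set_system R := within J _.
have FF : Filter F by rewrite {}/F; case: right; typeclasses eauto.
rewrite /dini limf_einfE -/F; split=> [le e e0|H].
  have lt : ((m - e)%:E < ereal_sup [set ereal_inf ((fun s => (slope h t s)%:E) @` V)
      | V in F])%E.
    by apply: lt_le_trans le; rewrite lte_fin; lra.
  have [_ [V VF <-] ltV] := ereal_sup_gt lt.
  apply: filterS VF => s Vs; rewrite -lee_fin; apply: le_trans (ltW ltV) _.
  by apply: ereal_inf_lbound; exists s.
apply/lee_addgt0Pr => e e0; rewrite -leeBlDr //.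
apply: le_ereal_sup_tmp.
exists (ereal_inf ((fun s => (slope h t s)%:E) @` [set s | m - e <= slope h t s])).
  by exists [set s | m - e <= slope h t s] => //; exact: H.
by apply: le_ereal_inf_tmp => _ [s /= ms <-]; rewrite lee_fin.
Qed.

Lemma dlower_dini J h t m : (forall right, (m%:E <= dini right J h t)%E) ->
  dlower J h t m.
Proof.
move=> H; split=> e e0; have := (dini_geP _ _ _ _ _).1 (H true) e e0.
have := (dini_geP _ _ _ _ _).1 (H false) e e0.
move=> /nbhs_ballP[d1 /= d10 H1] /nbhs_ballP[d2 /= d20 H2].
apply/near_dwithinP; exists (Num.min d1 d2); first by rewrite lt_min d10.
move=> s Js st; rewrite lt_min distrC => /andP[s1 s2].
have [ts|ts|ts] := ltgtP t s.
- exact: H2.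
- exact: H1.
- by rewrite ts eqxx in st.
Qed.

(** A one-sided Dini derivative sees only the points of [J] close to [t] on that side, so it
    suffices that [S] contains these. *)
Lemma dini_ge_dwithin right J S h g t m d : S t -> 0 < d ->
  (forall s, J s -> (if right then t < s < t + d else t - d < s < t) -> S s) ->
  (forall s, S s -> h s = g s) -> dwithin S g t m -> (m%:E <= dini right J h t)%E.
Proof.
move=> St d0 JS hg dg; apply/dini_geP => e e0.
have [d' d'0 H] := dlower_near (dwithin_dlower dg (lexx m)) e0.
have near_S s : J s -> `|s - t| < Num.min d d' -> (if right then t < s else s < t) ->
    m - e <= slope h t s.
  move=> Js; rewrite lt_min => /andP[sd sd'] side.
  have Ss : S s.
    apply: JS => //; move: sd; rewrite ltr_norml => /andP[? ?].
    by case: right side => ->; rewrite /=; lra.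
  have st : s != t by case: (right) side => ?; [rewrite gt_eqF|rewrite lt_eqF].
  by have := H s Ss st sd'; rewrite /slope !hg.
have m0 : 0 < Num.min d d' by rewrite lt_min d0.
case: right near_S {JS} => near_S; apply/nbhs_ballP; exists (Num.min d d') => //= s;
  by rewrite /ball/= distrC => sd ts Js; exact: near_S.
Qed.

End DiniBounds.

Section BrokenKinematic.
Context {R : realType} {n : nat} {I : finType} (M : manyBody R n I) (lambda : R).
Local Notation E := 'rV[R]_n.
Local Notation X := (mb_X M).
Local Notation st := (stratum M).
Local Notation kinematic := (kinematic M lambda).
Local Notation fibre := (fibre M lambda).
Implicit Types (J : set R) (w l xi z : E) (a b : I) (f : E * E -> R).

(** A unit vector [w] in [X b] excludes [X b = 0], so [b] lies strictly below the index 1 and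
    [lambda - |xi|^2] is a threshold. *)
Lemma finite_momenta : finite_set (thresholds M) ->
  exists ks : seq R, forall w z xi, dot w w = 1 -> fibre w z xi -> dot xi xi \in ks.
Proof.
move=> /finite_seqP[s sE]; exists [seq lambda - x | x <- s] => w z xi w1 [b [wb _ sb _]].
have bs : lambda - dot xi xi \in s.
  suff : thresholds M (lambda - dot xi xi) by rewrite sE.
  exists b => //=; rewrite /lt_index le_indexE mb_X_1 sub0v /=.
  apply/eqP => b1; move: wb; rewrite b1 mb_X_1 memv0 => /eqP w0.
  by move/eqP: w1; rewrite w0 dot0l eq_sym oner_eq0.
by apply/mapP; exists (lambda - dot xi xi) => //; rewrite subKr.
Qed.

Lemma Sigma_fibre b p : Sigma M b lambda p ->
  dot p.1 p.1 = 1 /\ fibre (compress M p).1 (compress M p).2 p.2.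
Proof. by move=> [[/= w1 wb] xib sb]; split=> //; exists b. Qed.

Section Broken.
Variables (J : set R) (gamma : R -> E * E).
Hypotheses (iJ : is_interval J) (broken : broken_bichar M lambda J gamma).
Let om t := (gamma t).1.
Let ze t := (gamma t).2.

Lemma broken_unit t : J t -> dot (om t) (om t) = 1.
Proof.
have [Hd _ _] := broken.
by move=> /Hd[b _ [p Sp pE]]; have [p1 _] := Sigma_fibre Sp; rewrite /om -pE.
Qed.

Lemma broken_fibre t : J t -> exists xi, fibre (om t) (ze t) xi.
Proof.
have [Hd _ _] := broken; move=> /Hd[b _ [p Sp pE]].
by have [_ fp] := Sigma_fibre Sp; exists p.2; rewrite /om /ze -pE.
Qed.

(** [compress] takes values in pairs again, so an invariant polynomial [f] serves as its own
    function on the compressed space. *)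
Lemma broken_dlower t f df m : J t -> polynomial_deriv f df ->
  (forall p, phase_space p -> f p = f (compress M p)) ->
  (forall xi, fibre (om t) (ze t) xi -> m <= df (ham_field (om t, xi)) (om t, xi)) ->
  dlower J (fun s => f (gamma s)) t m.
Proof.
move=> Jt Pf inv H; have [_ _ Hb] := broken; apply: dlower_dini => right.
apply: le_trans (Hb t right f f (st (om t)) Jt _ _); last 2 first.
- by split=> //; exact: poly_smooth Pf.
- by apply: C'_stratum; exact: broken_unit.
apply: le_ereal_inf_tmp => _ [p [b [_ Sp pE]] <-].
have [p1 fp] := Sigma_fibre Sp; rewrite lee_fin (poly_derive _ _ Pf).
have -> : p = (om t, p.2) by rewrite /om -pE; case: (p).
by apply: H; rewrite /om /ze -pE.
Qed.

Variable ks : seq R.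
Hypothesis ks_fibre : forall w z xi, dot w w = 1 -> fibre w z xi -> dot xi xi \in ks.

(** [|xi|^2] takes finitely many values, so its infimum over the fibre is attained. Thus the bound
    for [eta] is realized by an actual momentum. *)
Lemma fibre_minimal w z : dot w w = 1 -> (exists xi, fibre w z xi) ->
  exists xi, fibre w z xi /\ forall xi', fibre w z xi' -> dot xi xi <= dot xi' xi'.
Proof.
move=> w1 [xi0 f0]; pose A := [set dot xi xi | xi in [set xi | fibre w z xi]].
have infA : has_inf A.
  by split; [exists (dot xi0 xi0), xi0|exists 0 => _ [xi _ <-]; exact: dot_ge0].
have [e e0 gap] := finite_gap ks (inf A).
have [_ [xi f <-] lt] := inf_adherent e0 infA.
exists xi; split=> // xi' f'.
have le : inf A <= dot xi' xi' by apply: ge_inf; [exact: infA.2|exists xi'].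
apply: le_trans le; rewrite leNgt; apply/negP => lt'.
by have := gap _ (ks_fibre w1 f) lt'; rewrite leNgt lt.
Qed.

Lemma broken_eta t : J t -> exists xi, fibre (om t) (ze t) xi /\
  dlower J (fun s => dot (om s) (ze s)) t (2 * (dot xi xi - dot (om t) (ze t) ^+ 2)).
Proof.
move=> Jt; have w1 := broken_unit Jt.
have [xi [f fmin]] := fibre_minimal w1 (broken_fibre Jt).
exists xi; split=> //; apply: (broken_dlower Jt poly_dot) => [p p1|xi' f'].
  rewrite /= dotC (dotC p.1) -[in LHS](oproj_id (stratum_mem M p1.1)) -oproj_adj.
  by [].
rewrite /ham_field /= dot0r add0r dotZr dotBr dotZr (dotC xi' (om t)).
rewrite (fibre_eta w1 f') -expr2 ler_pM2l // lerD2r.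
exact: fmin.
Qed.

(** For [l] in the stratum the Hamilton derivative of [om . l] is the same at every momentum in the
    fibre; testing [l] and [- l] gives both bounds. *)
Lemma broken_om t l : J t -> l \in X (st (om t)) ->
  dwithin J (fun s => dot (om s) l) t
    (2 * (dot (ze t) l - dot (om t) (ze t) * dot (om t) l)).
Proof.
move=> Jt lX; have w1 := broken_unit Jt.
have H l' : l' \in X (st (om t)) -> dlower J (fun s => dot (om s) l') t
    (2 * (dot (ze t) l' - dot (om t) (ze t) * dot (om t) l')).
  move=> l'X; apply: (broken_dlower Jt (poly_dot_fst l')) => // xi f.
  by rewrite /ham_field /= dotZl dotBl dotZl (fibre_eta w1 f) (fibre_dot w1 f).
apply: dlower_dwithin; first exact: H.
have := H (- l); rewrite rpredN => /(_ lX); congr dlower.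
  by apply/funext => s; rewrite dotNr.
by rewrite !dotNr; ring.
Qed.

(** For [l] outside the stratum the Hamilton derivatives of [om . l] and of its negative vary with
    the momentum, but stay bounded over the fibre; this bounds slopes at [t] on both sides. *)
Lemma broken_om_continuous t l : J t ->
  (fun s => dot (om s) l) @ within J t^' --> dot (om t) l.
Proof.
move=> Jt; have w1 := broken_unit Jt.
(* Bounds [2 |xi . l - eta (om . l)|] over the fibre, with [|xi . l| <= 1 + |xi|^2 |l|^2] from
   Cauchy-Schwarz. *)
pose C := 2 * (1 + momentum_bound ks * dot l l) + 2 * `|dot (om t) (ze t) * dot (om t) l|.
have L0 := dot_ge0 l.
have B1 : 1 <= momentum_bound ks by rewrite lerDl sumr_ge0.
have C0 : 0 < C.
  have : 0 <= momentum_bound ks * dot l l by rewrite mulr_ge0 //; lra.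
  by have := normr_ge0 (dot (om t) (ze t) * dot (om t) l); rewrite /C; lra.
have H l' : dot l' l' = dot l l ->
    `|dot (om t) (ze t) * dot (om t) l'| = `|dot (om t) (ze t) * dot (om t) l| ->
    dlower J (fun s => dot (om s) l') t (- C).
  move=> l'l l'n; apply: (broken_dlower Jt (poly_dot_fst l')) => // xi f.
  rewrite /ham_field /= dotZl dotBl dotZl (fibre_eta w1 f) /C -l'n -l'l.
  have := ler_norm (dot (om t) (ze t) * dot (om t) l').
  have CS := dot_CS xi l'.
  have : dot xi xi * dot l' l' <= momentum_bound ks * dot l' l'.
    rewrite ler_wpM2r ?dot_ge0 // /momentum_bound.
    by have := mem_le_sum_norm (ks_fibre w1 f); lra.
  move: CS; move: (dot xi l') (dot xi xi * _) (momentum_bound ks * _) (_ * dot (om t) l').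
  move=> x y b c CS yb cc; nra.
have H1 := H l erefl erefl.
have H2 : dlower J (fun s => dot (om s) (- l)) t (- C).
  by apply: H; rewrite !dotNr ?dotNl ?opprK // mulrN normrN.
apply/cvg_dwithinP => e e0.
(* Taking [C] itself as the tolerance bounds the slopes by [2 C]. *)
have [d1 d10 h1] := dlower_near H1 C0; have [d2 d20 h2] := dlower_near H2 C0.
exists (Num.min (Num.min d1 d2) (e / (2 * C + 1))).
  by rewrite !lt_min d10 d20 divr_gt0 //; lra.
move=> s Js st_; rewrite !lt_min -andbA => /and3P[/(h1 s Js st_) {}h1 /(h2 s Js st_) {}h2].
rewrite ltr_pdivlMr; last lra.
have -> : dot (om s) l - dot (om t) l = slope (fun s => dot (om s) l) t s * (s - t).
  by rewrite /slope divfK // subr_eq0.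
rewrite normrM => sd.
have : `|slope (fun s => dot (om s) l) t s| <= 2 * C + 1.
  move: h2; rewrite (_ : slope _ _ _ = - slope (fun s => dot (om s) l) t s); last first.
    by rewrite -slopeN; congr slope; apply/funext => x; rewrite dotNr.
  by rewrite ler_norml; lra.
move=> sb; apply: le_lt_trans sd; rewrite mulrC ler_wpM2l //.
Qed.

Lemma cvg_rV (F : set_system R) (FF : Filter F) (u : R -> E) w :
  (forall l, (fun s => dot (u s) l) @ F --> dot w l) -> u @ F --> w.
Proof.
move=> H; rewrite [w]row_sum_delta.
rewrite (_ : u = fun s => \sum_(i < n) u s 0 i *: delta_mx 0 i); last first.
  by apply/funext => s; exact: row_sum_delta.
elim: (index_enum _) => [|i r IH].
  by rewrite big_nil; under eq_fun do rewrite big_nil; exact: cvg_cst.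
rewrite big_cons; under eq_fun do rewrite big_cons.
apply: cvgD => //; apply: cvgZ; last exact: cvg_cst.
by rewrite -(dot_delta w); under eq_fun do rewrite -dot_delta; exact: H.
Qed.

(* Testing with [phi (om) (ze.l - c)], where the polynomial [phi] vanishes on the
   members of [X] that do not contain the stratum of [om t]: the derivative
   along the Hamilton field is 0 at [t] for [c = ze t.l], as [ze.l - c] vanishes
   there. *)
Lemma broken_ze t l : J t -> l \in X (st (om t)) -> dwithin J (fun s => dot (ze s) l) t 0.
Proof.
move=> Jt lX; have w1 := broken_unit Jt; set a := st (om t) in lX.
pose dist b (p : E * E) := dot (p.1 - oproj (X b) p.1) (p.1 - oproj (X b) p.1).
pose phi p := \prod_(b | ~~ (X a <= X b)%VS) dist b p.
have [dphi Pphi] : exists df, polynomial_deriv phi df.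
  by apply: poly_prod => b; exact: poly_dist_fst.
pose c := dot (ze t) l.
(* The factor [e] is used with the values 1 and -1, for the two opposite bounds. *)
pose f e p := phi p * (dot p.2 (e *: l) + - (e * c)).
have Pf e := Poly_mul Pphi (Poly_add (poly_dot_snd (e *: l)) (Poly_cst (- (e * c)))).
(* Where [phi] vanishes both sides are 0, as [phi] depends on [p.1] alone. Elsewhere the stratum of
   [p.1] contains [X a], hence [l], and compression does not change the pairing with [l]. *)
have inv e p : phase_space p -> f e p = f e (compress M p).
  move=> [p1 _]; rewrite /f; have [phi0|phi0] := eqVneq (phi p) 0.
    by rewrite {1}phi0 (_ : phi (compress M p) = phi p) // phi0 !mul0r.
  rewrite /compress /=; congr (_ * (_ + _)).
  have aX : (X a <= X (st p.1))%VS.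
    apply: contraNT phi0 => aX; apply/prodf_eq0; exists (st p.1) => //.
    by rewrite /dist oproj_id ?stratum_mem // subrr dot0l.
  by rewrite oproj_dot // rpredZ // (subvP aX).
have D e : dlower J (fun s => f e (gamma s)) t 0.
  apply: (broken_dlower Jt (Pf e) (inv e)) => xi fxi /=.
  rewrite dot0l addr0 mulr0 add0r dotZr (fibre_dot w1 fxi) // -/c subrr mul0r //.
have F0 : dwithin J (fun s => f 1 (gamma s)) t 0.
  apply: dlower_dwithin => //; have := D (-1); rewrite oppr0; congr dlower.
  by apply/funext => s; rewrite /f !dotZr; ring.
have [F0'] := F0.
(* A zero momentum is inserted because [ze] need not be continuous, and [phi] does not see it. *)
have phic : (fun s => phi (om s, 0)) @ within J t^' --> phi (om t, 0).
  have cc : (fun s => (om s, 0 : E)) @ within J t^' --> (om t, 0 : E).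
    have c1 : om @ within J t^' --> om t.
      by apply: cvg_rV => l'; exact: broken_om_continuous.
    have c2 : (fun=> 0 : E) @ within J t^' --> (0 : E) by exact: cvg_cst.
    exact: cvg_pair c1 c2.
  apply: (cvg_comp _ _ cc).
  exact: differentiable_continuous (poly_differentiable _ Pphi).
have phi0 : phi (om t, 0) != 0.
  apply/prodf_neq0 => b ab; rewrite gt_eqF // dot_gt0 // subr_eq0 /=.
  apply: contra ab => /eqP omE; apply: stratum_min => //.
  by rewrite omE oproj_mem.
(* As [f 1] vanishes at [t], its slope is [phi] times the slope of [ze . l]; [phi] is continuous and
   nonzero at [t], so it can be divided out. *)
have H : (fun s => slope (fun s => f 1 (gamma s)) t s / phi (om s, 0)) @ within J t^' --> 0.
  by have := cvgM F0' (cvgV phi0 phic); rewrite mul0r; exact.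
split; apply: cvg_trans H; apply: near_eq_cvg.
have [d d0 dH] := (near_dwithinP _ _ _).1 (cvgr_neq0 _ phic phi0).
apply/near_dwithinP; exists d => // s Js st_ /(dH s Js st_) phis.
have f0 : f 1 (gamma t) = 0 by rewrite /f dotZr -/c mul1r subrr mulr0.
rewrite /slope f0 subr0 /f dotZr !mul1r.
by rewrite (_ : phi (gamma s) = phi (om s, 0)) // mulrAC (mulrC (phi _)) mulfK.
Qed.

Lemma broken_kinematic : kinematic J om ze.
Proof.
split=> //.
- exact: broken_unit.
- exact: broken_eta.
- exact: broken_om.
- exact: broken_ze.
- exact: broken_om_continuous.
Qed.

End Broken.
End BrokenKinematic.

(** * Segments versus integral curves, and the converse implication *)

Section SegmentsAndIntegralCurves.
Context {R : realType} {n : nat} {I : finType} (M : manyBody R n I) (lambda : R).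
Local Notation E := 'rV[R]_n.
Local Notation X := (mb_X M).
Local Notation st := (stratum M).
Implicit Types (J S : set R) (gamma : R -> E * E) (s t d : R) (a b : I).

Lemma segment_projected S gamma :
  (forall t, S t -> dot (gamma t).1 (gamma t).1 = 1) ->
  segment M lambda S (fun t => (gamma t).1) (fun t => (gamma t).2) ->
  projected_integral_curve M lambda S gamma.
Proof.
move=> g1 [b [xi H]]; exists b, (fun t => ((gamma t).1, xi)); split.
- by move=> t St; have [h1 h2 h3 _ _] := H t St; split=> //; split=> //; exact: g1.
- move=> t St; have [_ _ _ _ h5] := H t St.
  have c1 : (fun s => (s - t)^-1 *: ((gamma s).1 - (gamma t).1)) @ within S t^' -->
      (2 *: (xi - dot (gamma t).1 xi *: (gamma t).1)).
    apply: cvg_rV => l; have [] := h5 l; apply: cvg_trans; apply: near_eq_cvg.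
    apply/near_dwithinP; exists 1 => // s _ _ _.
    by rewrite dotZl dotBl mulrC.
  have c2 : (fun s => (s - t)^-1 *: (xi - xi)) @ within S t^' --> (0 : E).
    by rewrite subrr; under eq_fun do rewrite scaler0; exact: cvg_cst.
  exact: cvg_pair c1 c2.
- move=> t St; have [_ _ _ h4 _] := H t St; rewrite /compress /= h4.
  by case: (gamma t).
Qed.

(** The lift [c t] is one of the competitors in the infimum, by minimality of the stratum, and the
    chain rule along [c] produces exactly its Hamilton derivative. *)
Lemma projected_dini J S gamma (right : bool) t d f fpi a :
  projected_integral_curve M lambda S gamma -> S t -> 0 < d ->
  (forall s, J s -> (if right then t < s < t + d else t - d < s < t) -> S s) ->
  pi_invariant M f fpi -> C'_ M a (gamma t).1 ->
  (ereal_inf [set ('D_(ham_field p) f p)%:E | p in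
     [set p | exists b, [/\ C_ M a `<=` C_ M b, Sigma M b lambda p &
                            compress M p = gamma t]]]
   <= dini right J (fpi \o gamma) t)%E.
Proof.
move=> [b [c [Sc ic gc]]] St d0 JS [fs finv] Ca.
have dfc : differentiable f (c t) by exact: (fs [::]).
apply: (@le_trans _ _ ('D_(ham_field (c t)) f (c t))%:E).
  apply: ereal_inf_lbound; exists (c t) => //; exists b; split=> //; last by rewrite -gc.
  - have [[c1 cb] _ _] := Sc t St.
    have gE : (gamma t).1 = (c t).1 by rewrite gc.
    rewrite gE in Ca; have [_ amin] := (C'_P M a c1).1 Ca.
    by move=> x [x1 /= xa]; split=> //=; exact: subvP (amin b cb) _ xa.
  - exact: Sc.
rewrite deriveE //.
apply: (dini_ge_dwithin St d0 JS _ (dwithin_diff dfc (ic t St))) => s Ss.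
have [[c1 _] _ _] := Sc s Ss.
by rewrite /= gc // -finv //; split.
Qed.

(** Pieces are half-open so that a breakpoint is assigned to the piece following it; the mirror
    version assigns it to the preceding one. *)
Lemma piecewise_right (k : nat) (u : nat -> R) t :
  t < u 0%N \/ u k <= t \/ exists2 j, (j < k)%N & u j <= t < u j.+1.
Proof.
elim: k => [|k [|[|[j jk H]]]].
- by have [?|?] := ltP t (u 0%N); [left|right; left].
- by left.
- by have [?|?] := ltP t (u k.+1); [right; right; exists k => //; apply/andP|right; left].
- by right; right; exists j => //; exact: ltnW.
Qed.

Lemma piecewise_left (k : nat) (u : nat -> R) t :
  t <= u 0%N \/ u k < t \/ exists2 j, (j < k)%N & u j < t <= u j.+1.
Proof.
elim: k => [|k [|[|[j jk H]]]].
- by have [?|?] := leP t (u 0%N); [left|right; left].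
- by left.
- by have [?|?] := leP t (u k.+1); [right; right; exists k => //; apply/andP|right; left].
- by right; right; exists j => //; exact: ltnW.
Qed.

(** Each inequality concerns one side of [t], and near [t] that side lies in a single piece; at a
    breakpoint the two sides may use different momenta over the same compressed point. *)
Lemma piecewise_broken J gamma : (forall t, J t -> dotSigma M lambda (gamma t)) ->
  continuous_into_dotT M J gamma -> piecewise_projected M lambda J gamma ->
  broken_bichar M lambda J gamma.
Proof.
move=> Jd Jc [k [u [Ju umono [first middle last]]]]; split=> //.
move=> t right f fpi a Jt Pf Ca.
suff [S [pS St [d d0 Sd]]] : exists S, [/\ projected_integral_curve M lambda S gamma, S t &
    exists2 d, 0 < d & forall s, J s ->
      (if right then t < s < t + d else t - d < s < t) -> S s].
  exact: projected_dini pS St d0 Sd Pf Ca.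
case: right.
  have [tu|[ut|[j jk /andP[jt tj]]]] := piecewise_right k u t.
  - exists (J `&` `]-oo, u 0%N]); split=> //; first by split; rewrite //= in_itv /= ltW.
    exists (u 0%N - t); rewrite ?subr_gt0 // => s Js /andP[_ st_].
    by split; rewrite //= in_itv /= ltW //; lra.
  - exists (J `&` `[u k, +oo[); split=> //; first by split; rewrite //= in_itv /= andbT.
    exists 1 => // s Js /andP[ts _].
    by split; rewrite //= in_itv /= andbT (le_trans ut) // ltW.
  - exists [set` `[u j, u j.+1] ]; split; [exact: middle|by rewrite /= in_itv /= jt ltW|].
    exists (u j.+1 - t); rewrite ?subr_gt0 // => s Js /andP[ts st_].
    by rewrite /= in_itv /=; apply/andP; split; lra.
have [tu|[ut|[j jk /andP[jt tj]]]] := piecewise_left k u t.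
- exists (J `&` `]-oo, u 0%N]); split=> //.
  exists 1 => // s Js /andP[_ st_].
  by split; rewrite //= in_itv /= (le_trans (ltW st_) tu).
- exists (J `&` `[u k, +oo[); split=> //; first by split; rewrite //= in_itv /= andbT ltW.
  exists (t - u k); rewrite ?subr_gt0 // => s Js /andP[ts _].
  by split; rewrite //= in_itv /= andbT; lra.
- exists [set` `[u j, u j.+1] ]; split; [exact: middle|by rewrite /= in_itv /= tj andbT ltW|].
  exists (t - u j); rewrite ?subr_gt0 // => s Js /andP[ts st_].
  by rewrite /= in_itv /=; apply/andP; split; lra.
Qed.

Lemma broken_piecewise J gamma : is_interval J -> J !=set0 ->
  finite_set (thresholds M) -> broken_bichar M lambda J gamma ->
  piecewise_projected M lambda J gamma.
Proof.
move=> iJ J0 fin br; have [ks ks_fibre] := finite_momenta lambda fin.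
have kin := broken_kinematic iJ br ks_fibre.
have [k [t [Jt tmono [sl sm sr]]]] := kin_piecewise ks_fibre kin J0.
exists k, t; split=> //; split.
- apply: segment_projected => [s [Js _]|]; first exact: kin_unit kin _ Js.
  by apply: segment_sub sl => s [Js]; rewrite /= in_itv.
- move=> j jk; apply: segment_projected => [s|]; last exact: sm.
  rewrite /= in_itv /= => js; apply: (kin_unit kin).
  by apply: iJ js; apply: Jt => //; exact: ltnW.
- apply: segment_projected => [s [Js _]|]; first exact: kin_unit kin _ Js.
  by apply: segment_sub sr => s [Js]; rewrite /= in_itv /= andbT.
Qed.

End SegmentsAndIntegralCurves.

Theorem theorem5p10 (R : realType) (n : nat) (I : finType)
    (M : manyBody R n I) (lambda : R) (J : set R)
    (gamma : R -> 'rV[R]_n * 'rV[R]_n) :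
  is_interval J -> J !=set0 ->
  finite_set (thresholds M) ->
  (forall t, J t -> dotSigma M lambda (gamma t)) ->
  continuous_into_dotT M J gamma ->
  broken_bichar M lambda J gamma <-> piecewise_projected M lambda J gamma.
Proof.
move=> iJ J0 fin Jd Jc; split; first exact: broken_piecewise.
exact: piecewise_broken.
Qed.
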